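(* Fix $\mathsf{R}\ge 0$ and $0<\sigma_1^2<\sigma_2^2$, and assume Assumption (A) stated in the context. Then \[ \lim_{n \to \infty} C_s(\sigma_1^2, \sigma_2^2, \mathsf{R}, n) = \mathsf{R}^2 \left( \frac{1}{2\sigma_1^2}- \frac{1}{2\sigma_2^2} \right). \]
   Context: Vector Gaussian wiretap channel in dimension $n$: $\mathbf{Y}_1=\mathbf{X}+\mathbf{N}_1$, $\mathbf{Y}_2=\mathbf{X}+\mathbf{N}_2$, with $\mathbf{X}\in\mathbb{R}^n$, $\mathbf{N}_1\sim\mathcal{N}(\mathbf{0}_n,\sigma_1^2\mathbf{I}_n)$, $\mathbf{N}_2\sim\mathcal{N}(\mathbf{0}_n,\sigma_2^2\mathbf{I}_n)$, mutually independent with $\mathbf{X}$. $C_s(\sigma_1^2,\sigma_2^2,\mathsf{R},n)=\max I(\mathbf{X};\mathbf{Y}_1)-I(\mathbf{X};\mathbf{Y}_2)$ over distributions of $\mathbf{X}$ supported in $\{\|\mathbf{x}\|\le\mathsf{R}\}$. $\mathsf{h}_v(x)=\mathsf{I}_v(x)/\mathsf{I}_{v-1}(x)$ with $\mathsf{I}_v$ the modified Bessel function of the first kind. Assumption (A): for all $\mathsf{R}\ge0$, $0\le\sigma_1\le\sigma_2$, $n\in\mathbb{N}$, the function $y\mapsto \frac{1}{\sigma_2^2}\mathbb{E}\left[\frac{\mathsf{R}}{\|y\mathbf{e}_1+\mathbf{W}\|}\mathsf{h}_{\frac{n}{2}}\left(\frac{\mathsf{R}}{\sigma_2^2}\|y\mathbf{e}_1+\mathbf{W}\|\right)-1\right]-\frac{1}{\sigma_1^2}\left(\frac{\mathsf{R}}{y}\mathsf{h}_{\frac{n}{2}}\left(\frac{\mathsf{R}}{\sigma_1^2}y\right)-1\right)$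 has at most one sign change on $y>0$, where $\mathbf{W}\sim\mathcal{N}(\mathbf{0}_{n+2},(\sigma_2^2-\sigma_1^2)\mathbf{I}_{n+2})$ and $\mathbf{e}_1$ is the first unit vector of $\mathbb{R}^{n+2}$. *)

(* Defs.v *)
From HB Require Import structures.
From mathcomp Require Import all_boot all_order all_algebra.
From mathcomp Require Import all_classical all_reals all_analysis.
Set Implicit Arguments. Unset Strict Implicit. Unset Printing Implicit Defensive.
Import Order.TTheory GRing.Theory Num.Theory.
Import numFieldNormedType.Exports.
Local Open Scope classical_set_scope.
Local Open Scope ring_scope.

Section wiretap_defs.
Context {R : realType}.

(** Points of R^n are n-tuples of reals (measurable via the coordinate
    projections, library instance). Euclidean norm: *)
Definition tnorm (n : nat) (x : n.-tuple R) : R :=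
  Num.sqrt (\sum_(i < n) tnth x i ^+ 2).

Definition tsub (n : nat) (x y : n.-tuple R) : n.-tuple R :=
  [tuple tnth x i - tnth y i | i < n].

Fixpoint leb_int (n : nat) : (n.-tuple R -> R) -> R :=
  match n return (n.-tuple R -> R) -> R with
  | 0 => fun f => f [tuple]
  | m.+1 => fun f => Rintegral (@lebesgue_measure R) setT
             (fun t : R => leb_int (fun x : m.-tuple R => f [tuple of t :: x]))
  end.

(** Density of N(0_n, s^2 I_n) (s = standard deviation). *)
Definition gauss_dens (n : nat) (s : R) (z : n.-tuple R) : R :=
  \prod_(i < n) normal_pdf 0 s (tnth z i).

(** Output density of Y = X + N, N ~ N(0, s^2 I_n) independent of X ~ P. *)
Definition out_dens (n : nat) (s : R) (P : probability (n.-tuple R) R)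
    (y : n.-tuple R) : R :=
  Rintegral P setT (fun x => gauss_dens s (tsub y x)).

(** Mutual information I(X;Y) (in nats) for Y = X + N, X ~ P,
    N ~ N(0, s^2 I_n) independent of X:
    I(X;Y) = E_X[ D( P_{Y|X} || P_Y ) ]
           = \int dP(x) \int dy  p(y|x) ln (p(y|x) / p_Y(y)). *)
Definition gauss_MI (n : nat) (s : R) (P : probability (n.-tuple R) R) : R :=
  Rintegral P setT (fun x =>
    leb_int (fun y => gauss_dens s (tsub y x)
                      * ln (gauss_dens s (tsub y x) / out_dens s P y))).

Definition Cs (s1 s2 Rr : R) (n : nat) : R :=
  sup [set r : R | exists P : probability (n.-tuple R) R,
         P [set x | tnorm x <= Rr] = 1%E /\ r = gauss_MI s1 P - gauss_MI s2 P].

Definition Gamma (s : R) : R :=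
  Rintegral (@lebesgue_measure R) `]0, +oo[%classic
    (fun t => t `^ (s - 1) * expR (- t)).

Definition BesselI (v x : R) : R :=
  limn (series (fun k : nat =>
    (x / 2) `^ (2 * k%:R + v) / ((k`!)%:R * Gamma (k%:R + v + 1)))).

Definition bessel_h (v x : R) : R := BesselI v x / BesselI (v - 1) x.

Definition at_most_one_sign_change (f : R -> R) : Prop :=
  ~ (exists y1 y2 y3 : R, [/\ 0 < y1, y1 < y2 & y2 < y3] /\
       ((f y1 < 0 /\ 0 < f y2 /\ f y3 < 0) \/
        (0 < f y1 /\ f y2 < 0 /\ 0 < f y3))).

Definition shift_e1 (m : nat) (y : R) (w : m.-tuple R) : m.-tuple R :=
  [tuple (if (i : nat) == 0%N then y else 0) + tnth w i | i < m].

Definition assumpA_fun (Rr s1 s2 : R) (n : nat) (y : R) : R :=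
  (s2 ^+ 2)^-1 *
    leb_int (fun w : (n.+2).-tuple R =>
      gauss_dens (Num.sqrt (s2 ^+ 2 - s1 ^+ 2)) w *
      (Rr / tnorm (shift_e1 y w) *
         bessel_h (n%:R / 2) (Rr / s2 ^+ 2 * tnorm (shift_e1 y w)) - 1))
  - (s1 ^+ 2)^-1 * (Rr / y * bessel_h (n%:R / 2) (Rr / s1 ^+ 2 * y) - 1).

End wiretap_defs.

Definition AssumptionA (R : realType) : Prop :=
  forall (Rr s1 s2 : R) (n : nat), 0 <= Rr -> 0 < s1 -> s1 < s2 -> (0 < n)%N ->
    at_most_one_sign_change (assumpA_fun Rr s1 s2 n).

(* Main.v *)
Require Import Defs.
From HB Require Import structures.
From mathcomp Require Import all_boot all_order all_algebra.
From mathcomp Require Import all_classical all_reals all_analysis.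
From mathcomp Require Import measurable_realfun ring lra.
Import Order.TTheory GRing.Theory Num.Theory.
Import numFieldNormedType.Exports.
Local Open Scope classical_set_scope.
Local Open Scope ring_scope.

(** Write [phi_s] for the density of the noise of standard deviation [s], [r_s]
    for the ratio of the output density to [phi_s], and
    [psi r = r ln r - r + 1 >= 0].  Since [X] is bounded, Fubini gives
    [I(X;Y_s) = E|X|^2 / (2 s^2) - D_s] with [D_s = \int phi_s psi(r_s)], the
    divergence of the output from the pure noise.

    Upper bound: [Y_2] is [Y_1] plus an independent Gaussian, so [D_s2 <= D_s1]
    by convexity of [psi], and [E|X|^2 <= R^2].

    Lower bound: let [X] be uniform on the [n] points [R e_i].  Then
    [E|X|^2 = R^2], and [psi r <= (r - 1)^2] bounds [D_s1] by the chi-square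
    divergence, which for this input equals [(exp (R^2 / s1^2) - 1) / n]. *)

(** * Lebesgue measure on tuples *)

(** The capacity difference splits into an energy part, whose maximum [R^2] yields the limit, and
    the gap between the two divergences, which has to become negligible. The input must therefore
    sit on the sphere and still be almost invisible inside the noise. The chi-square divergence of
    an input is the mean of [exp (<X, X'> / s^2) - 1] over two independent copies. Orthogonal points
    of norm [R] contribute nothing to it, so only the coincidences [X = X'], of probability [1 / n],
    remain.

    The additive terms of [psi] integrate to zero but make the integrand nonnegative, so Tonelli
    applies to the divergence without a prior integrability argument.

    The analytic obstacle is that [leb_int] iterates real-valued integrals, in which an infinite
    inner integral would silently count as 0. Every function met here is therefore dominated by a
    Gaussian times [exp (b * |y|_1)]. The l1 norm makes this envelope a product over the
    coordinates, which reduces integrability in dimension [n] to dimension one. *)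

Section tlebesgue.
Context {R : realType}.

Local Notation S := (measurableTypeR R).

Definition tcons m (p : S * m.-tuple R) : m.+1.-tuple R := [tuple of p.1 :: p.2].
Definition tuncons m (x : m.+1.-tuple R) : S * m.-tuple R :=
  (thead x, [tuple of behead x]).

Lemma tconsK m : cancel (@tcons m) (@tuncons m).
Proof. by case=> t x; rewrite /tuncons /= theadE; congr pair; exact: val_inj. Qed.

Lemma tunconsK m : cancel (@tuncons m) (@tcons m).
Proof. by move=> x; rewrite [RHS](tuple_eta x). Qed.

Lemma measurable_tcons m : measurable_fun [set: S * m.-tuple R] (@tcons m).
Proof. exact: measurable_cons. Qed.

Lemma measurable_tuncons m :
  measurable_fun [set: m.+1.-tuple R] (@tuncons m).
Proof.
apply: measurable_fun_pair; last exact: measurable_behead.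
exact: measurable_tnth.
Qed.

HB.instance Definition _ m := isMeasurableFun.Build _ _ _ _
  (@tcons m) (@measurable_tcons m).

Section lebesgue_cons.
Variables (m : nat) (mu : {sigma_finite_measure set (m.-tuple R) -> \bar R}).

Definition lebesgue_cons : set (m.+1.-tuple R) -> \bar R :=
  pushforward (lebesgue_measure \x mu)%E (@tcons m).

Let lebesgue_cons0 : lebesgue_cons set0 = 0%E. Proof. exact: measure0. Qed.
Let lebesgue_cons_ge0 A : (0 <= lebesgue_cons A)%E.
Proof. exact: measure_ge0. Qed.
Let lebesgue_cons_sigma_additive : semi_sigma_additive lebesgue_cons.
Proof. exact: measure_semi_sigma_additive. Qed.

HB.instance Definition _ := isMeasure.Build _ _ _ lebesgue_cons
  lebesgue_cons0 lebesgue_cons_ge0 lebesgue_cons_sigma_additive.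

Let lebesgue_cons_sigma_finite : sigma_finite setT lebesgue_cons.
Proof.
have /sigma_finiteP[F [TF ndF Foo]] := sigma_finiteT (@lebesgue_measure R).
have /sigma_finiteP[G [TG ndG Goo]] := sigma_finiteT mu.
(* Both exhaustions are nondecreasing, so the single index [maxn i j] covers a point whose
   coordinates enter at stages [i] and [j]. *)
exists (fun k => @tuncons m @^-1` (F k `*` G k)).
  rewrite -preimage_bigcup (_ : \bigcup_i _ = setT) ?preimage_setT//.
  apply/seteqP; split=> // -[x y] _.
  have [i _ Fx] : (\bigcup_i F i) x by rewrite -TF.
  have [j _ Gy] : (\bigcup_j G j) y by rewrite -TG.
  exists (maxn i j) => //; split => /=.
    by move: Fx; exact/subsetPset/ndF/leq_maxl.
  by move: Gy; exact/subsetPset/ndG/leq_maxr.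
move=> k; have [mF Fk] := Foo k; have [mG Gk] := Goo k; split.
  rewrite -[X in measurable X]setTI; apply: measurable_tuncons => //.
  exact: measurableX.
rewrite /lebesgue_cons /pushforward (_ : _ @^-1` _ = F k `*` G k).
  by rewrite product_measure1E// lte_mul_pinfty// ge0_fin_numE.
by apply/seteqP; split=> p; rewrite /preimage /mkset tconsK.
Qed.

HB.instance Definition _ := Measure_isSigmaFinite.Build _ _ _ lebesgue_cons
  lebesgue_cons_sigma_finite.

End lebesgue_cons.

(** The recursion follows that of [leb_int]: a Dirac mass on the empty tuple, then one Lebesgue
    factor per coordinate. Sigma-finiteness is carried along because each product and each use of
    Fubini requires it. *)
Fixpoint tlebesgue n : {sigma_finite_measure set (n.-tuple R) -> \bar R} :=
  match n with
  | 0 => [the {sigma_finite_measure set _ -> \bar R} of \d_([tuple] : 0.-tuple R)]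
  | m.+1 => [the {sigma_finite_measure set _ -> \bar R} of lebesgue_cons m (tlebesgue m)]
  end.
End tlebesgue.

Section tlebesgue_integral.
Context {R : realType}.
Local Notation S := (measurableTypeR R).
Local Notation tl := (@tlebesgue R).

Lemma ge0_integral_tlebesgueS m (f : m.+1.-tuple R -> \bar R) :
  measurable_fun setT f -> (forall x, 0 <= f x)%E ->
  (\int[tl m.+1]_x f x =
   \int[lebesgue_measure]_t \int[tl m]_x f (tcons m (t, x)))%E.
Proof.
move=> mf f0.
rewrite [LHS](@ge0_integral_pushforward _ _ _ _ _ (tcons m))//=.
rewrite preimage_setT fubini_tonelli1//=.
exact: measurableT_comp.
Qed.

Lemma integrable_tcons m (f : m.+1.-tuple R -> \bar R) :
  (tl m.+1).-integrable setT f <->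
  (lebesgue_measure \x tl m)%E.-integrable setT (f \o tcons m).
Proof.
split=> /integrableP[mf foo]; apply/integrableP; split.
- exact: measurableT_comp.
- rewrite (le_lt_trans _ foo)// ge0_integral_tlebesgueS//; last first.
    exact: measurableT_comp.
  rewrite fubini_tonelli1//=.
  by do 2 apply: measurableT_comp => //.
- rewrite (_ : f = (f \o tcons m) \o tuncons m).
    by apply: measurableT_comp => //; exact: measurable_tuncons.
  by apply/funext => x /=; rewrite tunconsK.
- have mf' : measurable_fun setT f.
    rewrite (_ : f = (f \o tcons m) \o tuncons m).
      by apply: measurableT_comp => //; exact: measurable_tuncons.
    by apply/funext => x /=; rewrite tunconsK.
  rewrite ge0_integral_tlebesgueS//; last exact: measurableT_comp.
  rewrite (le_lt_trans _ foo)//.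
  by rewrite fubini_tonelli1//=;
    do 2 apply: measurableT_comp => //.
Qed.

Lemma integral_tlebesgueS m (f : m.+1.-tuple R -> \bar R) :
  (tl m.+1).-integrable setT f ->
  (\int[tl m.+1]_x f x =
   \int[lebesgue_measure]_t \int[tl m]_x f (tcons m (t, x)))%E.
Proof.
move=> fi; have /integrable_tcons fi' := fi.
rewrite [LHS](@integral_pushforward _ _ _ _ _ (tcons m))//=.
- by rewrite preimage_setT -integral12_prod_meas1.
- by case/integrableP : fi.
Qed.

End tlebesgue_integral.

(** * Products of one-variable functions, and [leb_int] as a genuine integral *)

Section tprod.
Context {R : realType}.
Local Notation S := (measurableTypeR R).
Local Notation tl := (@tlebesgue R).
Local Notation leb := (@lebesgue_measure R).

Lemma prod_tcons m (g : 'I_m.+1 -> R -> R) t (x : m.-tuple R) :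
  \prod_(i < m.+1) g i (tnth (tcons m (t, x)) i) =
  g ord0 t * \prod_(i < m) g (lift ord0 i) (tnth x i).
Proof.
by rewrite big_ord_recl tnth0; congr *%R; apply: eq_bigr => i _; rewrite tnthS.
Qed.

Lemma measurable_tprod n (g : 'I_n -> R -> R) :
  (forall i, measurable_fun setT (g i)) ->
  measurable_fun setT (fun x : n.-tuple R => \prod_(i < n) g i (tnth x i)).
Proof.
move=> mg; apply: measurable_prod => i _.
by apply: measurableT_comp => //; exact: measurable_tnth.
Qed.

Lemma integrable_tprod n (g : 'I_n -> R -> R) :
  (forall i, leb.-integrable setT (EFin \o g i)) ->
  (tl n).-integrable setT (fun x => (\prod_(i < n) g i (tnth x i))%:E).
Proof.
move=> ig.
have : measurable_fun setT
    (fun x : n.-tuple R => (\prod_(i < n) g i (tnth x i))%:E).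
  apply/measurable_EFinP; apply: measurable_tprod => i.
  by apply/measurable_EFinP; case/integrableP : (ig i).
elim: n g ig => [|m IH] g ig mp.
  apply/integrableP; split => //.
  rewrite integral_dirac//; last exact: measurableT_comp.
  by rewrite big_ord0/= diracT mul1e ltry.
apply/integrable_tcons; apply/integrable12ltyP; first exact: measurableT_comp.
have /integrableP[m0 i0] := ig ord0.
have ir : (tl m).-integrable setT
    (fun x => (\prod_(i < m) g (lift ord0 i) (tnth x i))%:E).
  have ig' i : leb.-integrable setT (EFin \o g (lift ord0 i)) by exact: ig.
  apply: (IH _ ig').
  apply/measurable_EFinP; apply: (measurable_tprod _ (fun i => g (lift ord0 i))) => i.
  by apply/measurable_EFinP; case/integrableP : (ig (lift ord0 i)).
have /integrableP[mr ir'] := ir.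
rewrite (eq_integral (fun t : S => `|(g ord0 t)%:E| *
  \int[tl m]_x `|(\prod_(i < m) g (lift ord0 i) (tnth x i))%:E|)%E); last first.
  move=> t _; rewrite -ge0_integralZl//; last exact: measurableT_comp.
  by apply: eq_integral => x _; rewrite -abseM -EFinM -prod_tcons.
rewrite ge0_integralZr//; first last.
- exact: integral_ge0.
- exact: measurableT_comp.
by rewrite lte_mul_pinfty// ?integral_ge0// ge0_fin_numE// integral_ge0.
Qed.

Lemma integral_tprod n (g : 'I_n -> R -> R) :
  (forall i, leb.-integrable setT (EFin \o g i)) ->
  (\int[tl n]_x (\prod_(i < n) g i (tnth x i))%:E =
   (\prod_(i < n) \int[leb]_t g i t)%:E)%E.
Proof.
elim: n g => [|m IH] g ig.
  rewrite integral_dirac//; first by rewrite !big_ord0 diracT mul1e.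
  by apply/measurable_EFinP; apply: measurable_tprod => -[].
rewrite integral_tlebesgueS; last exact: integrable_tprod.
rewrite (eq_integral (fun t : S => (g ord0 t)%:E *
  (\prod_(i < m) \int[leb]_t g (lift ord0 i) t)%:E)%E); last first.
  move=> t _; rewrite -(IH (fun i => g (lift ord0 i))); last by move=> i; exact: ig.
  rewrite -integralZl//; last first.
    by apply: (integrable_tprod _ (fun i => g (lift ord0 i))) => i; exact: ig.
  by apply: eq_integral => x _; rewrite -EFinM -prod_tcons.
rewrite integralZr//; last exact: ig.
rewrite big_ord_recl EFinM; congr (_ * _)%E.
by rewrite fineK//; exact: (integrable_fin_num measurableT (ig ord0)).
Qed.

(** A product envelope is stable under the induction: freezing the first coordinate at [t] replaces
    [C] by [C * g ord0 t] and leaves a product over the others. Hence every section is integrable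
    and [fine] loses nothing at any stage. *)
Lemma leb_intE n (f : n.-tuple R -> R) (C : R) (g : 'I_n -> R -> R) :
  measurable_fun setT f ->
  (forall i, leb.-integrable setT (EFin \o g i)) ->
  (forall x, `|f x| <= C * \prod_(i < n) g i (tnth x i)) ->
  leb_int f = \int[tl n]_x f x.
Proof.
elim: n f C g => [|m IH] f C g mf ig fg.
  rewrite /= /Rintegral integral_dirac//; last exact/measurable_EFinP.
  by rewrite diracT mul1e.
have fi : (tl m.+1).-integrable setT (EFin \o f).
  apply: (@le_integrable _ _ _ (tl m.+1) setT measurableT _
    (fun x => C%:E * (\prod_(i < m.+1) g i (tnth x i))%:E)%E).
  - exact/measurable_EFinP.
  - by move=> x _ /=; rewrite lee_fin (le_trans (fg x))// ler_norm.
  - by apply: integrableZl => //; exact: integrable_tprod.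
rewrite /= /Rintegral integral_tlebesgueS//; congr fine.
apply: eq_integral => t _.
have mt : measurable_fun setT (fun x : m.-tuple R => f (tcons m (t, x))).
  apply: measurableT_comp => //.
  by apply: (measurable_cons (f := cst t) (g := id)).
have gt x : `|f (tcons m (t, x))| <= C * g ord0 t *
    \prod_(i < m) g (lift ord0 i) (tnth x i).
  by rewrite -mulrA -prod_tcons.
transitivity ((\int[tl m]_x f (tcons m (t, x)))%:E).
  congr EFin; exact: (IH (fun x => f (tcons m (t, x))) _
    (fun i => g (lift ord0 i)) mt (fun i => ig (lift ord0 i)) gt).
rewrite /Rintegral fineK//; apply: integrable_fin_num => //.
apply: (@le_integrable _ _ _ (tl m) setT measurableT _
    (fun x => (C * g ord0 t)%:E * (\prod_(i < m) g (lift ord0 i) (tnth x i))%:E)%E).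
- exact/measurable_EFinP.
- by move=> x _ /=; rewrite lee_fin (le_trans (gt x))// ler_norm.
- apply: integrableZl => //.
  exact: (integrable_tprod _ (fun i => g (lift ord0 i))).
Qed.

End tprod.

(** * Gaussian densities *)

Section normal1.
Context {R : realType}.
Local Notation S := (measurableTypeR R).
Local Notation leb := (@lebesgue_measure R).
Implicit Types (a b s t B : R).

Lemma normal_pdf_exp a s t : s != 0 ->
  normal_pdf a s t = normal_peak s * expR (- (t - a) ^+ 2 / (s ^+ 2 *+ 2)).
Proof. by move=> s0; rewrite normal_pdfE. Qed.

Lemma normal_pdf_shift a b s t : s != 0 ->
  normal_pdf a s (t - b) = normal_pdf (a + b) s t.
Proof. by move=> s0; rewrite !normal_pdf_exp// -addrA -opprD (addrC b). Qed.

(** Exponential tilting: a shift of the mean is a change of density against the centred law. *)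
Lemma normal_pdf_tilt a s t : s != 0 ->
  normal_pdf a s t =
  normal_pdf 0 s t * expR ((2 * (a * t) - a ^+ 2) / (2 * s ^+ 2)).
Proof.
by move=> s0; rewrite !normal_pdf_exp// -mulrA -expRD; congr (_ * expR _); field.
Qed.

Lemma normal_pdf_expR B s t : s != 0 ->
  normal_pdf 0 s t * expR (B * t) =
  expR (B ^+ 2 * s ^+ 2 / 2) * normal_pdf (B * s ^+ 2) s t.
Proof.
move=> s0; rewrite !normal_pdf_exp// [RHS]mulrCA -[LHS]mulrA -!expRD.
by congr (_ * expR _); field.
Qed.

Lemma normal_pdf_reflect a s t : s != 0 ->
  normal_pdf a s (2 * a - t) = normal_pdf a s t.
Proof.
move=> s0; rewrite !normal_pdf_exp//.
suff -> : 2 * a - t - a = - (t - a) by rewrite sqrrN.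
by ring.
Qed.

Lemma normal_pdf_gt0 a s t : s != 0 -> 0 < normal_pdf a s t.
Proof.
move=> s0; rewrite normal_pdf_exp// mulr_gt0 ?expR_gt0 ?normal_peak_gt0//.
Qed.

Lemma expR_norm_le B t : expR (B * `|t|) <= expR (B * t) + expR (- B * t).
Proof.
have [t0|t0] := leP 0 t; first by rewrite ger0_norm// lerDl expR_ge0.
by rewrite ltr0_norm// mulrN mulNr lerDr expR_ge0.
Qed.

(** After [expR_norm_le] removes the absolute value, completing the square turns each exponential
    times the density into a multiple of a shifted normal density. *)
Lemma integrable_normal_expR_norm B s : s != 0 ->
  leb.-integrable setT (fun t : S => (normal_pdf 0 s t * expR (B * `|t|))%:E).
Proof.
move=> s0.
have mexp C : measurable_fun setT (fun t : R => expR (C * t)).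
  by apply: measurableT_comp => //; exact: measurable_funM.
have iexp C : leb.-integrable setT (fun t : S => (normal_pdf 0 s t * expR (C * t))%:E).
  under eq_fun do rewrite normal_pdf_expR// EFinM.
  by apply: integrableZl => //; exact: integrable_normal_pdf.
apply: (@le_integrable _ _ _ leb setT measurableT _
  (fun t : S => (normal_pdf 0 s t * expR (B * t))%:E +
                (normal_pdf 0 s t * expR (- B * t))%:E)%E).
- apply/measurable_EFinP; apply: measurable_funM; first exact: measurable_normal_pdf.
  apply: measurableT_comp => //; apply: measurable_funM => //.
- move=> t _ /=; rewrite lee_fin -mulrDr !normrM ler_wpM2l//.
  by rewrite ger0_norm ?expR_ge0// (le_trans (expR_norm_le B t))// ler_norm.
- exact: integrableD.
Qed.

Definition reflect b (t : S) : S := b - t.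

Lemma measurable_reflect b : measurable_fun setT (reflect b).
Proof. exact: (measurable_funB (measurable_cst (b:R)) (@measurable_id _ S setT)). Qed.

HB.instance Definition _ b := isMeasurableFun.Build _ _ _ _
  (reflect b) (measurable_reflect b).

(** By uniqueness of Lebesgue measure it is enough to compare lengths of half-open intervals;
    reflection only moves the closed end to the other side. *)
Lemma lebesgue_measure_reflect b (A : set S) : measurable A ->
  pushforward leb (reflect b) A = leb A.
Proof.
move=> mA.
apply/esym; apply: lebesgue_measure_unique => //= _ [[c d]] _ <-.
rewrite /pushforward.
rewrite (_ : _ @^-1` _ = `[b - d, b - c[%classic); last first.
  apply/seteqP; split => t /=; rewrite /reflect !in_itv/= => /andP[? ?];
    by apply/andP; split; lra.
rewrite !lebesgue_measure_itv/= !lte_fin.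
rewrite ltrD2l ltrN2; case: ifPn => // _; rewrite -!EFinB; congr EFin; ring.
Qed.

Lemma Rintegral_reflect b (f : R -> R) :
  leb.-integrable setT (fun t : S => (f t)%:E) ->
  \int[leb]_t f (b - t) = \int[leb]_t f t.
Proof.
move=> fi; have [mf foo] := integrableP _ _ _ fi.
have eqm (A : set S) : measurable A -> A `<=` setT ->
    pushforward leb (reflect b) A = leb A.
  by move=> mA _; exact: lebesgue_measure_reflect.
have eqI (g : S -> \bar R) :
    (\int[pushforward leb (reflect b)]_t g t = \int[leb]_t g t)%E.
  exact: eq_measure_integral.
rewrite /Rintegral -[in RHS]eqI; congr fine.
rewrite (@integral_pushforward _ _ _ _ _ (reflect b))//.
rewrite preimage_setT; apply/integrableP; split; first exact: measurableT_comp.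
rewrite (le_lt_trans _ foo)// -[leRHS]eqI.
by rewrite (@ge0_integral_pushforward _ _ _ _ _ (reflect b))//; exact: measurableT_comp.
Qed.

Lemma integrable_normal_pdfM a s : s != 0 ->
  leb.-integrable setT (fun t : S => (normal_pdf a s t * t)%:E).
Proof.
move=> s0.
(* Tilting back to mean 0 costs [exp (|a| |t| / s^2)]; the extra 1 in the exponent absorbs the
   factor [t], since [|t| <= exp |t|]. *)
apply: (@le_integrable _ _ _ leb setT measurableT _ (fun t : S =>
  (expR (- a ^+ 2 / (2 * s ^+ 2)))%:E *
  (normal_pdf 0 s t * expR ((`|a| / s ^+ 2 + 1) * `|t|))%:E)%E).
- apply/measurable_EFinP; apply: measurable_funM => //.
  exact: measurable_normal_pdf.
- move=> t _ /=; rewrite lee_fin [leRHS]ger0_norm; last first.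
    by rewrite !mulr_ge0 ?expR_ge0 ?normal_pdf_ge0.
  rewrite normrM ger0_norm ?normal_pdf_ge0// normal_pdf_tilt//.
  rewrite [leRHS]mulrCA -[leLHS]mulrA ler_wpM2l ?normal_pdf_ge0//.
  have -> : (2 * (a * t) - a ^+ 2) / (2 * s ^+ 2) =
    - a ^+ 2 / (2 * s ^+ 2) + a * t / s ^+ 2 by field.
  have -> : expR ((`|a| / s ^+ 2 + 1) * `|t|) =
      expR (`|a| / s ^+ 2 * `|t|) * expR `|t : R| :> R.
    by rewrite -expRD mulrDl mul1r.
  rewrite expRD -[leLHS]mulrA ler_wpM2l ?expR_ge0//.
  apply: ler_pM; rewrite ?expR_ge0//.
    rewrite ler_expR [leRHS]mulrAC ler_wpM2r ?invr_ge0 ?sqr_ge0// -normrM.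
    exact: ler_norm.
  by apply: le_trans (expR_ge1Dx _); rewrite lerDr.
- apply: integrableZl => //; exact: integrable_normal_expR_norm.
Qed.

Lemma Rintegral_normal_pdf a s : \int[leb]_t normal_pdf a s t = 1.
Proof. by rewrite /Rintegral integral_normal_pdf. Qed.

(** The density is symmetric about [a], so reflecting [t] to [2 * a - t] shows that the mean [M]
    satisfies [M = 2 * a - M]. *)
Lemma Rintegral_normal_pdfM a s : s != 0 -> \int[leb]_t (normal_pdf a s t * t) = a.
Proof.
move=> s0; have ip := @integrable_normal_pdf R a s.
have ipM := integrable_normal_pdfM a s s0.
suff : \int[leb]_t (normal_pdf a s t * t) =
    2 * a - \int[leb]_t (normal_pdf a s t * t) by lra.
rewrite -[LHS](Rintegral_reflect (2 * a))//.
transitivity (\int[leb]_t (normal_pdf a s t * (2 * a) - normal_pdf a s t * t)).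
  apply: eq_Rintegral => t _; rewrite -mulrBr; congr *%R.
  exact: normal_pdf_reflect.
rewrite RintegralB//; last first.
  exact: (integrableZr measurableT (2 * a) ip).
by rewrite RintegralZr// Rintegral_normal_pdf mul1r.
Qed.

(** Bayes' rule for Gaussians: prior times likelihood equals marginal times posterior. The posterior
    of [z] given [y] has mean [y * s1 ^+ 2 / s ^+ 2] and deviation [s1 * s2 / s]; integrating it out
    gives the convolution formula. *)
Lemma normal_pdfM_pdf s1 s2 s y z : 0 < s1 -> 0 < s2 -> 0 < s ->
  s ^+ 2 = s1 ^+ 2 + s2 ^+ 2 ->
  normal_pdf 0 s1 z * normal_pdf 0 s2 (y - z) =
  normal_pdf 0 s y * normal_pdf (y * s1 ^+ 2 / s ^+ 2) (s1 * s2 / s) z.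
Proof.
move=> s10 s20 s0 sE.
have sn : s != 0 by rewrite gt_eqF.
have s1n : s1 != 0 by rewrite gt_eqF.
have s2n : s2 != 0 by rewrite gt_eqF.
rewrite !normal_pdf_exp ?mulf_neq0 ?invr_neq0//.
rewrite mulrACA [RHS]mulrACA -!expRD; congr (_ * expR _).
  rewrite /normal_peak -!invfM; congr (_ ^-1).
  rewrite -!sqrtrM ?mulrn_wge0 ?mulr_ge0 ?pi_ge0 ?ltW//.
  by congr (Num.ExtraDef.sqrtr _); move: pi => p; field.
rewrite (_ : (s1 * s2 / s) ^+ 2 = s1 ^+ 2 * s2 ^+ 2 / s ^+ 2).
  rewrite sE; field.
  by rewrite s1n s2n andbT -sE expf_neq0.
by rewrite !exprMn exprVn.
Qed.

Lemma normal_pdfM_pdf_shift s1 s2 s a y z : 0 < s1 -> 0 < s2 -> 0 < s ->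
  s ^+ 2 = s1 ^+ 2 + s2 ^+ 2 ->
  normal_pdf 0 s1 (z - a) * normal_pdf 0 s2 (y - z) = normal_pdf 0 s (y - a) *
    normal_pdf ((y - a) * s1 ^+ 2 / s ^+ 2 + a) (s1 * s2 / s) z.
Proof.
move=> s10 s20 s0 sE; rewrite -normal_pdf_shift ?gt_eqF ?divr_gt0 ?mulr_gt0//.
rewrite -normal_pdfM_pdf//; congr (_ * normal_pdf _ _ _).
by rewrite opprB addrA subrK.
Qed.

Lemma integrable_normal_pdf_conv s1 s2 s a y : 0 < s1 -> 0 < s2 -> 0 < s ->
  s ^+ 2 = s1 ^+ 2 + s2 ^+ 2 ->
  leb.-integrable setT
    (fun z : S => (normal_pdf 0 s1 (z - a) * normal_pdf 0 s2 (y - z))%:E).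
Proof.
move=> s10 s20 s0 sE.
under eq_fun do rewrite (normal_pdfM_pdf_shift _ _ _ _ _ _ s10 s20 s0 sE).
exact: (integrableZl measurableT (normal_pdf 0 s (y - a)) (@integrable_normal_pdf _ _ _)).
Qed.

Lemma Rintegral_normal_pdf_conv s1 s2 s a y : 0 < s1 -> 0 < s2 -> 0 < s ->
  s ^+ 2 = s1 ^+ 2 + s2 ^+ 2 ->
  \int[leb]_z (normal_pdf 0 s1 (z - a) * normal_pdf 0 s2 (y - z)) =
  normal_pdf 0 s (y - a).
Proof.
move=> s10 s20 s0 sE.
under eq_Rintegral do rewrite (normal_pdfM_pdf_shift _ _ _ _ _ _ s10 s20 s0 sE).
rewrite RintegralZl//; last exact: integrable_normal_pdf.
by rewrite Rintegral_normal_pdf mulr1.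
Qed.

End normal1.

(** * Gaussian vectors with independent coordinates *)

Section gaussn.
Context {R : realType}.
Local Notation S := (measurableTypeR R).
Local Notation leb := (@lebesgue_measure R).
Local Notation tl := (@tlebesgue R).
Variable n : nat.
Local Notation T := (n.-tuple R).
Implicit Types (x y : n.-tuple R) (s B : R).

Definition tdot x y : R := \sum_(i < n) tnth x i * tnth y i.
Definition tsq x : R := \sum_(i < n) tnth x i ^+ 2.
Definition tl1 x : R := \sum_(i < n) `|tnth x i|.
(** The likelihood ratio at [y] of noise centred at [x] against noise centred at the origin. *)
Definition tilt s x y : R := expR ((2 * tdot x y - tsq x) / (2 * s ^+ 2)).

Lemma tsq_ge0 x : 0 <= tsq x.
Proof. by apply: sumr_ge0 => i _; exact: sqr_ge0. Qed.

Lemma measurable_tsq : measurable_fun setT tsq.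
Proof.
apply: measurable_sum => i; apply: measurable_funX; exact: measurable_tnth.
Qed.

Lemma measurable_tnorm : measurable_fun setT (@tnorm R n).
Proof.
apply: (measurableT_comp (f := @Num.sqrt R)); last exact: measurable_tsq.
apply: measurable_realfun.continuous_measurable_fun; exact: sqrt_continuous.
Qed.

Lemma measurable_tdot :
  measurable_fun setT (fun p : T * T => tdot p.1 p.2).
Proof.
apply: measurable_sum => i; apply: measurable_funM.
  by apply: (measurableT_comp (measurable_tnth i)).
by apply: (measurableT_comp (measurable_tnth i)).
Qed.

Lemma measurable_tilt s :
  measurable_fun setT (fun p : T * T => tilt s p.1 p.2).
Proof.
apply: measurableT_comp => //; apply: measurable_funM => //.
apply: measurable_funB.
  by apply: measurable_funM => //; exact: measurable_tdot.
by apply: (measurableT_comp measurable_tsq).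
Qed.

Lemma tilt_gt0 s x y : 0 < tilt s x y. Proof. exact: expR_gt0. Qed.

Lemma gauss_dens_tsubE s x y : s != 0 ->
  gauss_dens s (tsub y x) = \prod_(i < n) normal_pdf (tnth x i) s (tnth y i).
Proof.
move=> s0; apply: eq_bigr => i _.
by rewrite tnth_mktuple normal_pdf_shift// add0r.
Qed.

Lemma gauss_dens_gt0 s y : s != 0 -> 0 < gauss_dens s y.
Proof. by move=> s0; apply: prodr_gt0 => i _; exact: normal_pdf_gt0. Qed.

Lemma gauss_dens_tilt s x y : s != 0 ->
  gauss_dens s (tsub y x) = gauss_dens s y * tilt s x y.
Proof.
move=> s0; rewrite gauss_dens_tsubE//.
under eq_bigr do rewrite normal_pdf_tilt//.
rewrite big_split /=; congr *%R; rewrite -expR_sum; congr expR.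
by rewrite -mulr_suml sumrB -mulr_sumr.
Qed.

Lemma gauss_dens_tsub0 s y : gauss_dens s (tsub y (nseq_tuple n 0)) = gauss_dens s y.
Proof. by apply: eq_bigr => i _; rewrite tnth_mktuple tnth_nseq subr0. Qed.

Lemma measurable_gauss_dens s : measurable_fun setT (@gauss_dens R n s).
Proof.
by apply: (measurable_tprod _ (fun _ => normal_pdf 0 s)) => i; exact: measurable_normal_pdf.
Qed.

Lemma integrable_gauss_dens s x : s != 0 ->
  (tl n).-integrable setT (fun y => (gauss_dens s (tsub y x))%:E).
Proof.
move=> s0; under eq_fun do rewrite gauss_dens_tsubE//.
apply: (integrable_tprod _ (fun i => normal_pdf (tnth x i) s)) => i.
exact: integrable_normal_pdf.
Qed.

Lemma Rintegral_gauss_dens s x : s != 0 ->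
  \int[tl n]_y gauss_dens s (tsub y x) = 1.
Proof.
move=> s0; under eq_Rintegral do rewrite gauss_dens_tsubE//.
rewrite /Rintegral (integral_tprod _ (fun i => normal_pdf (tnth x i) s))/=.
  by apply: big1 => i _; exact: Rintegral_normal_pdf.
by move=> i; exact: integrable_normal_pdf.
Qed.

Lemma gauss_dens_expR s B y : gauss_dens s y * expR (B * tl1 y) =
  \prod_(i < n) (normal_pdf 0 s (tnth y i) * expR (B * `|tnth y i|)).
Proof. by rewrite big_split/= -expR_sum -mulr_sumr. Qed.

Lemma integrable_gauss_expR s B : s != 0 ->
  (tl n).-integrable setT (fun y => (gauss_dens s y * expR (B * tl1 y))%:E).
Proof.
move=> s0; under eq_fun do rewrite gauss_dens_expR.
apply: (integrable_tprod _ (fun _ t => normal_pdf 0 s t * expR (B * `|t|))) => i.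
exact: integrable_normal_expR_norm.
Qed.

(** Padding the single coordinate [tnth y j] with factors 1 gives a full product, so first moments
    fall under the product formula. *)
Lemma gauss_dens_tnth s x y j : s != 0 ->
  gauss_dens s (tsub y x) * tnth y j =
  \prod_(i < n) (normal_pdf (tnth x i) s (tnth y i) *
                 (if i == j then tnth y i else 1)).
Proof.
move=> s0; rewrite gauss_dens_tsubE// [RHS]big_split/=; congr *%R.
by rewrite -big_mkcond big_pred1_eq.
Qed.

Let mom x j s (i : 'I_n) (t : R) :=
  normal_pdf (tnth x i) s t * (if i == j then t else 1).

Let integrable_mom x j s i : s != 0 ->
  leb.-integrable setT (fun t : S => (mom x j s i t)%:E).
Proof.
move=> s0; rewrite /mom; case: (i == j); first exact: integrable_normal_pdfM.
rewrite (_ : (fun t => _) = (fun t : S => (normal_pdf (tnth x i) s t)%:E)).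
  exact: integrable_normal_pdf.
by apply/funext => t; rewrite mulr1.
Qed.

Lemma integrable_gauss_tnth s x j : s != 0 ->
  (tl n).-integrable setT (fun y => (gauss_dens s (tsub y x) * tnth y j)%:E).
Proof.
move=> s0; under eq_fun do rewrite gauss_dens_tnth//.
by apply: (integrable_tprod _ (mom x j s)) => i; exact: integrable_mom.
Qed.

Lemma Rintegral_gauss_tnth s x j : s != 0 ->
  \int[tl n]_y (gauss_dens s (tsub y x) * tnth y j) = tnth x j.
Proof.
move=> s0; under eq_Rintegral do rewrite gauss_dens_tnth//.
rewrite /Rintegral (integral_tprod _ (mom x j s))/=; last first.
  by move=> i; exact: integrable_mom.
rewrite (bigD1 j)//= /mom eqxx Rintegral_normal_pdfM// big1 ?mulr1// => i ij.
by rewrite (negbTE ij); under eq_Rintegral do rewrite mulr1; exact: Rintegral_normal_pdf.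
Qed.

Lemma integrable_gauss_tdot s x : s != 0 ->
  (tl n).-integrable setT (fun y => (gauss_dens s (tsub y x) * tdot x y)%:E).
Proof.
move=> s0.
rewrite (_ : (fun y => _) = (fun y => \sum_(j < n) ((tnth x j)%:E *
    (gauss_dens s (tsub y x) * tnth y j)%:E))%E); last first.
  apply/funext => y; rewrite mulr_sumr -sumEFin; apply: eq_bigr => j _.
  by rewrite -EFinM mulrCA.
apply: integrable_sum => // j _.
by apply: (integrableZl measurableT); exact: integrable_gauss_tnth.
Qed.

Lemma Rintegral_gauss_tdot s x : s != 0 ->
  \int[tl n]_y (gauss_dens s (tsub y x) * tdot x y) = tsq x.
Proof.
move=> s0.
have ij j : (tl n).-integrable setT
    (fun y => ((tnth x j)%:E * (gauss_dens s (tsub y x) * tnth y j)%:E)%E).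
  by apply: (integrableZl measurableT); exact: integrable_gauss_tnth.
rewrite /Rintegral.
rewrite (eq_integral (fun y => \sum_(j < n) ((tnth x j)%:E *
    (gauss_dens s (tsub y x) * tnth y j)%:E))%E); last first.
  move=> y _; rewrite mulr_sumr -sumEFin; apply: eq_bigr => j _.
  by rewrite -EFinM mulrCA.
rewrite integral_sum//.
rewrite (eq_bigr (fun j => (tnth x j ^+ 2)%:E)); first by rewrite sumEFin.
move=> j _; rewrite integralZl//; last exact: integrable_gauss_tnth.
rewrite expr2 EFinM; congr (_ * _)%E.
rewrite -[in RHS](Rintegral_gauss_tnth s x j s0) /Rintegral fineK//.
by apply: integrable_fin_num => //; exact: integrable_gauss_tnth.
Qed.

Let conv s1 s2 x y (i : 'I_n) (t : R) :=
  normal_pdf 0 s1 (t - tnth x i) * normal_pdf 0 s2 (tnth y i - t).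

Let convE s1 s2 x y z :
  gauss_dens s1 (tsub z x) * gauss_dens s2 (tsub y z) =
  \prod_(i < n) conv s1 s2 x y i (tnth z i).
Proof.
by rewrite -big_split; apply: eq_bigr => i _; rewrite !tnth_mktuple.
Qed.

Lemma integrable_gauss_conv s1 s2 s x y : 0 < s1 -> 0 < s2 -> 0 < s ->
  s ^+ 2 = s1 ^+ 2 + s2 ^+ 2 -> (tl n).-integrable setT
    (fun z => (gauss_dens s1 (tsub z x) * gauss_dens s2 (tsub y z))%:E).
Proof.
move=> s10 s20 s0 sE; under eq_fun do rewrite convE.
apply: (integrable_tprod _ (conv s1 s2 x y)) => i.
exact: (integrable_normal_pdf_conv _ _ s).
Qed.

Lemma Rintegral_gauss_conv s1 s2 s x y : 0 < s1 -> 0 < s2 -> 0 < s ->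
  s ^+ 2 = s1 ^+ 2 + s2 ^+ 2 ->
  \int[tl n]_z (gauss_dens s1 (tsub z x) * gauss_dens s2 (tsub y z)) =
  gauss_dens s (tsub y x).
Proof.
move=> s10 s20 s0 sE; under eq_Rintegral do rewrite convE.
rewrite /Rintegral (integral_tprod _ (conv s1 s2 x y))/=; last first.
  by move=> i; exact: (integrable_normal_pdf_conv _ _ s).
apply: eq_bigr => i _; rewrite tnth_mktuple.
exact: Rintegral_normal_pdf_conv.
Qed.

End gaussn.

(** * Measurability of integrals depending on a parameter *)

Section fubini_measurability.
Context d1 d2 (T1 : measurableType d1) (T2 : measurableType d2) {R : realType}.

(** Tonelli measurability is applied to the positive and negative parts separately. *)
Lemma measurable_Rintegral_snd (m : {sigma_finite_measure set T2 -> \bar R})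
    (f : T1 * T2 -> R) : measurable_fun setT f ->
  measurable_fun setT (fun x => \int[m]_y f (x, y)).
Proof.
move=> /measurable_EFinP mf.
rewrite /Rintegral; apply: measurableT_comp => //.
rewrite (_ : (fun x => _) = fun x =>
    (fubini_F m (EFin \o f)^\+ x - fubini_F m (EFin \o f)^\- x)%E); last first.
  apply/funext => x; rewrite integralE /fubini_F.
  by congr (_ - _)%E; apply: eq_integral => y _; rewrite unlock.
apply: emeasurable_funB; apply: measurable_fun_fubini_tonelli_F => //.
  exact: measurable_funepos.
exact: measurable_funeneg.
Qed.

End fubini_measurability.

Lemma measurable_Rintegral_fst d1 d2 (T1 : measurableType d1)
    (T2 : measurableType d2) (R : realType)
    (m : {sigma_finite_measure set T1 -> \bar R})
    (f : T1 * T2 -> R) : measurable_fun setT f ->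
  measurable_fun setT (fun y => \int[m]_x f (x, y)).
Proof.
move=> mf; apply: (measurable_Rintegral_snd _ _ _ _ m (fun p => f (p.2, p.1))).
by apply: measurableT_comp => //; exact: measurable_fun_pair.
Qed.

(** * Bounds on the likelihood ratio over a Euclidean ball *)

Section ball.
Context {R : realType} (n : nat).
Local Notation T := (n.-tuple R).
Implicit Types (x y : n.-tuple R) (s K : R).

Lemma tnth_le_tnorm x i : `|tnth x i| <= tnorm x.
Proof.
rewrite -sqrtr_sqr ler_wsqrtr// (bigD1 i)//= lerDl.
by apply: sumr_ge0 => j _; exact: sqr_ge0.
Qed.

Lemma tnorm_ge0 x : 0 <= tnorm x. Proof. exact: sqrtr_ge0. Qed.

Lemma measurable_tnorm_le K : measurable [set x : T | tnorm x <= K].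
Proof.
rewrite (_ : [set x | _] = (@tnorm R n) @^-1` [set` `]-oo, K]]); last first.
  by apply/seteqP; split => x /=; rewrite in_itv.
by rewrite -[X in measurable X]setTI; exact: measurable_tnorm.
Qed.

Lemma tsq_tnorm x : tsq n x = tnorm x ^+ 2.
Proof. by rewrite sqr_sqrtr// tsq_ge0. Qed.

Lemma tsq_le x K : tnorm x <= K -> tsq n x <= K ^+ 2.
Proof.
by move=> xK; rewrite tsq_tnorm lerXn2r ?nnegrE ?tnorm_ge0// (le_trans (tnorm_ge0 x)).
Qed.

Lemma tdot_le x y K : tnorm x <= K -> `|tdot n x y| <= K * tl1 n y.
Proof.
move=> xK; rewrite (le_trans (ler_norm_sum _ _ _))// mulr_sumr.
apply: ler_sum => i _; rewrite normrM ler_wpM2r//.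
exact: le_trans (tnth_le_tnorm x i) xK.
Qed.

(** The source of the two constants that recur below: the log-likelihood ratio grows at rate
    [K / s ^+ 2] in [tl1 n y], with offset [K ^+ 2 / (2 * s ^+ 2)]. *)
Lemma tilt_arg_le s x y K : s != 0 -> tnorm x <= K ->
  `|(2 * tdot n x y - tsq n x) / (2 * s ^+ 2)| <=
  K / s ^+ 2 * tl1 n y + K ^+ 2 / (2 * s ^+ 2).
Proof.
move=> s0 xK; have s20 : 0 < s ^+ 2 by rewrite exprn_even_gt0.
have s2 : 0 < 2 * s ^+ 2 by rewrite mulr_gt0.
rewrite normrM [X in _ * X]gtr0_norm ?invr_gt0// ler_pdivrMr//.
have -> : (K / s ^+ 2 * tl1 n y + K ^+ 2 / (2 * s ^+ 2)) * (2 * s ^+ 2) =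
  2 * (K * tl1 n y) + K ^+ 2 by field.
rewrite (le_trans (ler_normB _ _))// lerD//.
  by rewrite normrM ger0_norm// ler_wpM2l// tdot_le.
by rewrite ger0_norm ?tsq_ge0// tsq_le.
Qed.

Lemma tilt_le s x y K : s != 0 -> tnorm x <= K ->
  tilt n s x y <= expR (K / s ^+ 2 * tl1 n y + K ^+ 2 / (2 * s ^+ 2)).
Proof.
by move=> s0 xK; rewrite ler_expR (le_trans _ (tilt_arg_le _ _ y _ s0 xK))// ler_norm.
Qed.

Lemma tilt_ge s x y K : s != 0 -> tnorm x <= K ->
  expR (- (K / s ^+ 2 * tl1 n y + K ^+ 2 / (2 * s ^+ 2))) <= tilt n s x y.
Proof.
move=> s0 xK; rewrite ler_expR lerNl (le_trans _ (tilt_arg_le _ _ y _ s0 xK))//.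
by rewrite -normrN ler_norm.
Qed.

End ball.

(** * Output densities of ball-supported inputs *)

Section input.
Context {R : realType} (n : nat).
Local Notation T := (n.-tuple R).
Local Notation tl := (@tlebesgue R n).
Variables (P : probability T R) (Rr : R).
Implicit Types (x y : n.-tuple R) (s K : R).

Let ball : set T := [set x | tnorm x <= Rr].
Hypothesis hP : P ball = 1%E.

(* Integrals over [P] carry this weight instead of being restricted to the
   ball: joint integrands then stay defined on a full product space, where the
   Fubini theorems apply. *)
Definition wball x : R := \1_ball x.

Let mball : measurable ball. Proof. exact: measurable_tnorm_le. Qed.

Lemma measurable_wball : measurable_fun setT wball.
Proof. exact: measurable_indic. Qed.

Lemma wball_cases x : (wball x = 1 /\ tnorm x <= Rr) \/ wball x = 0.
Proof.
rewrite /wball indicE; case: (boolP (x \in ball)); last by right.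
by rewrite inE; left.
Qed.

Lemma wball_ge0 x : 0 <= wball x.
Proof. by case: (wball_cases x) => [[->]|->]. Qed.

Lemma Rintegral_wball (f : T -> R) : measurable_fun setT f ->
  \int[P]_x f x = \int[P]_x (wball x * f x).
Proof.
move=> mf; rewrite /Rintegral; congr fine; apply: ae_eq_integral => //.
- exact/measurable_EFinP.
- by apply/measurable_EFinP; apply: measurable_funM => //; exact: measurable_wball.
exists (~` ball); split; first exact: measurableC.
  by rewrite [LHS](probability_setC P mball) hP subee.
move=> x /= h xB; apply: h => _.
case: (wball_cases x) => [[-> _]|]; first by rewrite mul1r.
by rewrite /wball indicE mem_set// => /eqP; rewrite oner_eq0.
Qed.

Lemma integrable_wball (f : T -> R) (C : R) : measurable_fun setT f ->
  (forall x, tnorm x <= Rr -> `|f x| <= C) -> 0 <= C ->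
  P.-integrable setT (fun x => (wball x * f x)%:E).
Proof.
move=> mf fC C0.
apply: (@le_integrable _ _ _ P setT measurableT _ (EFin \o cst C)).
- by apply/measurable_EFinP; apply: measurable_funM => //; exact: measurable_wball.
- move=> x _ /=; rewrite lee_fin (ger0_norm C0).
  by case: (wball_cases x) => [[->] /fC|->]; rewrite ?mul1r// mul0r normr0.
- exact: finite_measure_integrable_cst.
Qed.

Lemma integral_wball1 : \int[P]_x (wball x * 1) = 1.
Proof.
rewrite -Rintegral_wball; last exact: measurable_cst.
by rewrite Rintegral_cst// [X in fine X](probability_setT P) mul1r.
Qed.

Lemma integrable_wball1 : P.-integrable setT (fun x => (wball x * 1)%:E).
Proof. by apply: (integrable_wball _ 1) => // x _; rewrite normr1. Qed.

Section likelihood_ratio.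
Variable s : R.
Hypothesis s0 : s != 0.

(** The ratio [r_s]: dividing the output density by the noise density under the integral leaves the
    average of [tilt], as [out_densE] confirms. *)
Definition lratio y : R := \int[P]_x (wball x * tilt n s x y).

Let B : R := Rr / s ^+ 2.
Let c : R := Rr ^+ 2 / (2 * s ^+ 2).

Let measurable_tilt_l y : measurable_fun setT (fun x => tilt n s x y).
Proof.
apply: (measurableT_comp (measurable_tilt n s) (g := fun x : T => (x, y))).
exact: measurable_pair2.
Qed.

Lemma integrable_tilt y : P.-integrable setT (fun x => (wball x * tilt n s x y)%:E).
Proof.
apply: (integrable_wball _ (expR (B * tl1 n y + c))); rewrite ?expR_ge0//.
by move=> x xR; rewrite ger0_norm ?tilt_le// ltW// tilt_gt0.
Qed.

Lemma lratio_le y : lratio y <= expR (B * tl1 n y + c).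
Proof.
rewrite -[leRHS]mulr1 -integral_wball1 -RintegralZl//; last exact: integrable_wball1.
apply: le_Rintegral => //.
- exact: integrable_tilt.
- exact: (integrableZl measurableT (expR (B * tl1 n y + c)) integrable_wball1).
move=> x _; rewrite mulr1 mulrC.
by case: (wball_cases x) => [[-> /(tilt_le n s x y Rr s0)]|->]; rewrite ?mulr1 ?mulr0.
Qed.

Lemma lratio_ge y : expR (- (B * tl1 n y + c)) <= lratio y.
Proof.
rewrite -[leLHS]mulr1 -integral_wball1 -RintegralZl//; last exact: integrable_wball1.
apply: le_Rintegral => //.
- exact: (integrableZl measurableT (expR (- (B * tl1 n y + c))) integrable_wball1).
- exact: integrable_tilt.
move=> x _; rewrite mulr1 [leRHS]mulrC.
by case: (wball_cases x) => [[-> /(tilt_ge n s x y Rr s0)]|->]; rewrite ?mulr1 ?mulr0.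
Qed.

Lemma lratio_gt0 y : 0 < lratio y.
Proof. exact: lt_le_trans (expR_gt0 _) (lratio_ge y). Qed.

(** The exponential lower bound matters as much as the upper one: together they keep the logarithm
    linear in [tl1 n y], hence integrable against the Gaussian. *)
Lemma ln_lratio_le y : `|ln (lratio y)| <= B * tl1 n y + c.
Proof.
rewrite ler_norml -ler_expR lnK ?posrE ?lratio_gt0// lratio_ge/=.
by rewrite -ler_expR lnK ?posrE ?lratio_gt0// lratio_le.
Qed.

Lemma measurable_lratio : measurable_fun setT lratio.
Proof.
apply: (measurable_Rintegral_fst _ _ _ _ _ P
  (fun p : T * T => wball p.1 * tilt n s p.1 p.2)).
apply: measurable_funM; last exact: measurable_tilt.
by apply: (measurableT_comp measurable_wball).
Qed.

Lemma out_densE y : out_dens s P y = gauss_dens s y * lratio y.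
Proof.
rewrite /out_dens /lratio -RintegralZl//; last exact: integrable_tilt.
rewrite Rintegral_wball; last first.
  under eq_fun do rewrite gauss_dens_tilt//.
  exact: measurable_funM.
by apply: eq_Rintegral => x _; rewrite gauss_dens_tilt// mulrCA.
Qed.

End likelihood_ratio.
End input.

(** * Exchanging the integrals over input and output *)

Section mixture.
Context {R : realType} (n : nat).
Local Notation T := (n.-tuple R).
Local Notation tl := (@tlebesgue R n).
Variables (P : probability T R) (Rr : R).
Implicit Types (x y : n.-tuple R) (s K : R).
Hypothesis hP : P [set x | tnorm x <= Rr] = 1%E.
Variable s : R.
Hypothesis s0 : s != 0.
Local Notation w := (wball n Rr).
Local Notation lr := (lratio n P Rr s).
Let B : R := Rr / s ^+ 2.
Let c : R := Rr ^+ 2 / (2 * s ^+ 2).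

(** Recentring the noise at the origin multiplies by [tilt], which only raises the rate [b] by
    [K / s ^+ 2] and the constant by an exponential factor; the envelope keeps its shape. *)
Lemma gauss_dens_dom (G : T -> R) (A b K : R) x y : tnorm x <= K ->
  `|G y| <= A * expR (b * tl1 n y) ->
  `|gauss_dens s (tsub y x) * G y| <= A * expR (K ^+ 2 / (2 * s ^+ 2)) *
    (gauss_dens s y * expR ((K / s ^+ 2 + b) * tl1 n y)).
Proof.
move=> xK Gb; rewrite gauss_dens_tilt// !normrM ger0_norm; last first.
  exact/ltW/gauss_dens_gt0.
rewrite [leRHS]mulrCA -mulrA ler_wpM2l//; first exact/ltW/gauss_dens_gt0.
rewrite [leRHS](_ : _ = expR (K / s ^+ 2 * tl1 n y + K ^+ 2 / (2 * s ^+ 2)) *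
    (A * expR (b * tl1 n y))); last first.
  by rewrite (mulrDl (K / s ^+ 2)) !expRD; ring.
by rewrite ler_pM// ger0_norm ?tilt_le// ltW// tilt_gt0.
Qed.

Lemma integrable_gauss_dom (F : T -> R) (A b : R) : measurable_fun setT F ->
  (forall y, `|F y| <= A * (gauss_dens s y * expR (b * tl1 n y))) ->
  tl.-integrable setT (EFin \o F).
Proof.
move=> mF Fb; apply: (@le_integrable _ _ _ tl setT measurableT _
  (fun y => A%:E * (gauss_dens s y * expR (b * tl1 n y))%:E)%E).
- exact/measurable_EFinP.
- by move=> y _ /=; rewrite lee_fin (le_trans (Fb y))// ler_norm.
- by apply: (integrableZl measurableT); exact: integrable_gauss_expR.
Qed.

Lemma leb_int_gauss_dom (F : T -> R) (A b : R) : measurable_fun setT F ->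
  (forall y, `|F y| <= A * (gauss_dens s y * expR (b * tl1 n y))) ->
  leb_int F = \int[tl]_y F y.
Proof.
move=> mF Fb; apply: (leb_intE _ _ A
  (fun _ t => normal_pdf 0 s t * expR (b * `|t|))) => //.
- by move=> _; exact: integrable_normal_expR_norm.
- by move=> y; rewrite -gauss_dens_expR.
Qed.

Lemma measurable_gauss_tsub :
  measurable_fun setT (fun p : T * T => gauss_dens s (tsub p.2 p.1)).
Proof.
under eq_fun do rewrite gauss_dens_tilt//.
apply: measurable_funM; last exact: measurable_tilt.
by apply: (measurableT_comp (measurable_gauss_dens n s)).
Qed.

Lemma measurable_gauss_tsub1 x :
  measurable_fun setT (fun y => gauss_dens s (tsub y x)).
Proof.
apply: (measurableT_comp measurable_gauss_tsub (g := fun y : T => (x, y))).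
exact: measurable_pair1.
Qed.

Section dominated.
Variables (G : T -> R) (A b : R).
Hypothesis mG : measurable_fun setT G.
Hypothesis Gb : forall y, `|G y| <= A * expR (b * tl1 n y).

Lemma integrable_gauss_tsubM x :
  tl.-integrable setT (fun y => (gauss_dens s (tsub y x) * G y)%:E).
Proof.
apply: (integrable_gauss_dom _ (A * expR (tnorm x ^+ 2 / (2 * s ^+ 2)))
  (tnorm x / s ^+ 2 + b)).
  by apply: measurable_funM => //; exact: measurable_gauss_tsub1.
by move=> y; exact: gauss_dens_dom.
Qed.

Let h (p : T * T) : R := w p.1 * (gauss_dens s (tsub p.2 p.1) * G p.2).

Let mh : measurable_fun setT h.
Proof.
apply: measurable_funM; first by apply: (measurableT_comp (measurable_wball n Rr)).
apply: measurable_funM; first exact: measurable_gauss_tsub.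
by apply: (measurableT_comp mG).
Qed.

Let C := A * expR (Rr ^+ 2 / (2 * s ^+ 2)).
Let env y := gauss_dens s y * expR ((Rr / s ^+ 2 + b) * tl1 n y).

Let A0 : 0 <= A.
Proof.
(* The bound at one point, here the origin, already forces the sign of [A]. *)
have := le_trans (normr_ge0 _) (Gb (nseq_tuple n 0)).
by rewrite pmulr_lge0// expR_gt0.
Qed.

Let C0 : 0 <= C. Proof. by rewrite mulr_ge0 ?expR_ge0. Qed.

Let h_le x y : `|h (x, y)| <= C * env y.
Proof.
rewrite /h /=; case: (wball_cases n Rr x) => [[-> xR]|->].
  by rewrite mul1r; exact: gauss_dens_dom.
rewrite mul0r normr0 mulr_ge0// mulr_ge0 ?expR_ge0//.
exact/ltW/gauss_dens_gt0.
Qed.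

(** The envelope depends on [y] alone, so the inner integrals are bounded by one constant, which is
    integrable against a probability. *)
Let ih : (P \x tl)%E.-integrable setT (EFin \o h).
Proof.
have ienv : tl.-integrable setT (fun y => C%:E * (env y)%:E)%E.
  by apply: (integrableZl measurableT); exact: integrable_gauss_expR.
apply/integrable12ltyP; first exact/measurable_EFinP.
apply: (@le_lt_trans _ _ (\int[P]_x (\int[tl]_y (C * env y))%:E)%E); last first.
  by rewrite integral_cst// [X in (_ * X)%E](probability_setT P) mule1 ltry.
apply: ge0_le_integral => //.
- by move=> x _; exact: integral_ge0.
- apply: (@measurable_fun_fubini_tonelli_F _ _ _ _ _ tl (abse \o (EFin \o h))) => //; last first.
    by move=> p; exact: abse_ge0.
  by apply: measurableT_comp => //; exact/measurable_EFinP.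
- move=> x _; rewrite /Rintegral fineK; last exact: (integrable_fin_num measurableT ienv).
  apply: ge0_le_integral => //.
  + apply: measurableT_comp => //; apply/measurable_EFinP.
    by apply: (measurableT_comp mh (g := fun y : T => (x, y))); exact: measurable_pair1.
  + by case/integrableP : ienv.
  + by move=> y _; rewrite lee_fin h_le.
Qed.

Let Jx x : (\int[tl]_y (h (x, y))%:E =
  (w x * \int[tl]_y (gauss_dens s (tsub y x) * G y))%:E)%E.
Proof.
rewrite -RintegralZl//; last exact: integrable_gauss_tsubM.
rewrite /Rintegral fineK//.
exact: (integrable_fin_num measurableT (integrableZl measurableT (w x) (integrable_gauss_tsubM x))).
Qed.

Let Jy y : (\int[P]_x (h (x, y))%:E = (gauss_dens s y * lr y * G y)%:E)%E.
Proof.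
have iw : P.-integrable setT (fun x => (w x * tilt n s x y)%:E).
  exact: integrable_tilt.
rewrite (eq_integral (fun x => (gauss_dens s y * G y)%:E * (w x * tilt n s x y)%:E)%E); last first.
  move=> x _; rewrite -EFinM /h /= gauss_dens_tilt//; congr EFin; ring.
rewrite integralZl// [in RHS]mulrAC [RHS]EFinM; congr (_ * _)%E.
by rewrite /lratio /Rintegral fineK//; exact: (integrable_fin_num measurableT iw).
Qed.

Lemma integrable_mixture_input :
  P.-integrable setT (fun x => (w x * \int[tl]_y (gauss_dens s (tsub y x) * G y))%:E).
Proof.
have := integrable_fubini_F ih.
by apply: eq_integrable => // x _; rewrite /fubini_F Jx.
Qed.

Lemma integrable_mixture_output :
  tl.-integrable setT (fun y => (gauss_dens s y * lr y * G y)%:E).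
Proof.
apply: (integrable_gauss_dom _ (A * expR c) (B + b)).
  apply: measurable_funM => //; apply: measurable_funM.
    exact: measurable_gauss_dens.
  exact: measurable_lratio.
move=> y; rewrite -mulrA normrM ger0_norm; last exact/ltW/gauss_dens_gt0.
rewrite [leRHS]mulrCA ler_wpM2l//; first exact/ltW/gauss_dens_gt0.
rewrite [leRHS](_ : _ = expR (B * tl1 n y + c) * (A * expR (b * tl1 n y))).
  by rewrite normrM ler_pM// gtr0_norm ?lratio_gt0// lratio_le.
by rewrite (mulrDl B) !expRD; ring.
Qed.

(** Fubini for the joint law of input and output. It is used with [G] constant (total mass 1), with
    [G] the logarithm of the ratio (mutual information) and with [G] a Gaussian kernel (additional
    noise). *)
Lemma Rintegral_mixture :
  \int[P]_x (w x * \int[tl]_y (gauss_dens s (tsub y x) * G y)) =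
  \int[tl]_y (gauss_dens s y * lr y * G y).
Proof.
rewrite /Rintegral; congr fine.
transitivity (\int[P]_x \int[tl]_y (EFin \o h) (x, y))%E.
  by apply: eq_integral => x _; rewrite Jx.
by rewrite (Fubini ih); apply: eq_integral => y _; rewrite Jy.
Qed.

End dominated.
End mixture.

(** * Mutual information as energy minus divergence *)

Section psi.
Context {R : realType}.
Implicit Types a b : R.

Definition psi a := a * ln a - a + 1.

(** Convexity in tangent form, [ln b] being the derivative of [psi] at [b]. It is [1 + u <= exp u]
    at [u = ln b - ln a], multiplied by [a]. *)
Lemma psi_tangent a b : 0 < a -> 0 < b -> psi b + ln b * (a - b) <= psi a.
Proof.
move=> a0 b0; have := expR_ge1Dx (ln b - ln a).
rewrite expRB !lnK ?posrE// ler_pdivlMr// /psi => h.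
nra.
Qed.

Lemma psi_ge0 a : 0 < a -> 0 <= psi a.
Proof.
by move=> a0; have := psi_tangent a 1 a0 ltr01; rewrite /psi ln1; lra.
Qed.

Lemma psi_le_sqr a : 0 < a -> psi a <= (a - 1) ^+ 2.
Proof.
move=> a0; have := expR_ge1Dx (ln a).
rewrite lnK ?posrE// /psi => h.
nra.
Qed.

End psi.

Section mutual_information.
Context {R : realType} (n : nat).
Local Notation T := (n.-tuple R).
Local Notation tl := (@tlebesgue R n).
Variables (P : probability T R) (Rr : R).
Implicit Types (x y : n.-tuple R) (K : R).
Hypothesis hP : P [set x | tnorm x <= Rr] = 1%E.
Variable s : R.
Hypothesis s0 : s != 0.
Local Notation w := (wball n Rr).
Local Notation lr := (lratio n P Rr s).
Let B : R := Rr / s ^+ 2.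
Let c : R := Rr ^+ 2 / (2 * s ^+ 2).

Definition kl : R := \int[tl]_y (gauss_dens s y * psi (lr y)).

Let ln_lr_dom y : `|ln (lr y)| <= expR c * expR (B * tl1 n y).
Proof.
rewrite -expRD addrC; apply: le_trans (ln_lratio_le _ _ _ hP _ s0 y) _.
by rewrite (le_trans _ (expR_ge1Dx _))// lerDr.
Qed.

Lemma measurable_ln_lratio : measurable_fun setT (fun y => ln (lr y)).
Proof. by apply: measurableT_comp => //; exact: measurable_lratio. Qed.

Lemma integrable_gauss_lr :
  tl.-integrable setT (fun y => (gauss_dens s y * lr y * 1)%:E).
Proof.
apply: (integrable_mixture_output n P Rr hP s s0 (cst 1) 1 0) => // y.
by rewrite mul0r expR0 mulr1 normr1.
Qed.

Lemma Rintegral_gauss_lr : \int[tl]_y (gauss_dens s y * lr y * 1) = 1.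
Proof.
rewrite -(Rintegral_mixture n P Rr s s0 (cst 1) 1 0) => //; last first.
  by move=> y; rewrite mul0r expR0 mulr1 normr1.
rewrite -[RHS](integral_wball1 n P Rr hP); apply: eq_Rintegral => x _.
congr *%R; under eq_Rintegral do rewrite mulr1.
exact: Rintegral_gauss_dens.
Qed.

Lemma integrable_gauss0 : tl.-integrable setT (fun y => (gauss_dens s y)%:E).
Proof.
have := integrable_gauss_expR n s 0 s0.
by apply: eq_integrable => // y _; rewrite mul0r expR0 mulr1.
Qed.

Lemma Rintegral_gauss0 : \int[tl]_y gauss_dens s y = 1.
Proof.
rewrite -(Rintegral_gauss_dens n s (nseq_tuple n 0) s0).
by apply: eq_Rintegral => y _; rewrite gauss_dens_tsub0.
Qed.

Lemma integrable_gauss_lr_ln :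
  tl.-integrable setT (fun y => (gauss_dens s y * lr y * ln (lr y))%:E).
Proof.
apply: (integrable_mixture_output n P Rr hP s s0 _ (expR c) B) => //.
exact: measurable_ln_lratio.
Qed.

Let gauss_psiE y : gauss_dens s y * psi (lr y) =
  gauss_dens s y * lr y * ln (lr y) - gauss_dens s y * lr y * 1 + gauss_dens s y.
Proof. by rewrite /psi; ring. Qed.

Lemma integrable_gauss_psi :
  tl.-integrable setT (fun y => (gauss_dens s y * psi (lr y))%:E).
Proof.
have i1 := integrableB measurableT integrable_gauss_lr_ln integrable_gauss_lr.
have := integrableD measurableT i1 integrable_gauss0.
by apply: eq_integrable => // y _; rewrite gauss_psiE EFinD EFinB.
Qed.

(** Output and noise densities both have mass 1, so the part [- r + 1] of [psi] cancels and the
    usual relative entropy remains. *)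
Lemma klE : kl = \int[tl]_y (gauss_dens s y * lr y * ln (lr y)).
Proof.
have i1 := integrableB measurableT integrable_gauss_lr_ln integrable_gauss_lr.
rewrite /kl; under eq_Rintegral do rewrite gauss_psiE.
rewrite RintegralD//; last exact: integrable_gauss0.
rewrite RintegralB//; [|exact: integrable_gauss_lr_ln|exact: integrable_gauss_lr].
by rewrite Rintegral_gauss_lr Rintegral_gauss0 subrK.
Qed.

Lemma kl_ge0 : 0 <= kl.
Proof.
apply: Rintegral_ge0 => y _; apply: mulr_ge0; first exact/ltW/gauss_dens_gt0.
by apply: psi_ge0; exact: lratio_gt0.
Qed.

(** The noise density cancels in the quotient, so its logarithm is that of [tilt] minus that of
    [lr]. The former is affine in [y], and its mean under noise centred at [x] is
    [|x|^2 / (2 s^2)]. *)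
Let inner x : leb_int (fun y => gauss_dens s (tsub y x)
    * ln (gauss_dens s (tsub y x) / out_dens s P y)) =
  (2 * s ^+ 2)^-1 * tsq n x - \int[tl]_y (gauss_dens s (tsub y x) * ln (lr y)).
Proof.
pose H y := (2 * tdot n x y - tsq n x) / (2 * s ^+ 2) - ln (lr y).
have FE y : gauss_dens s (tsub y x) * ln (gauss_dens s (tsub y x) / out_dens s P y)
    = gauss_dens s (tsub y x) * H y.
  congr *%R; rewrite (out_densE n P Rr hP s s0) gauss_dens_tilt//.
  have g0 : gauss_dens s y != 0 by rewrite gt_eqF// gauss_dens_gt0.
  rewrite -mulf_div divff// mul1r ln_div ?posrE ?tilt_gt0 ?lratio_gt0//.
  by rewrite expRK.
have -> : (fun y => gauss_dens s (tsub y x)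
    * ln (gauss_dens s (tsub y x) / out_dens s P y)) =
    (fun y => gauss_dens s (tsub y x) * H y) by apply/funext => y; exact: FE.
(* The identity is wanted for every [x], also outside the ball, so the envelope uses the norm of [x]
   itself instead of [Rr]. *)
pose K := tnorm x.
have Hb y : `|H y| <= expR (K ^+ 2 / (2 * s ^+ 2) + c) * expR ((K / s ^+ 2 + B) * tl1 n y).
  rewrite -expRD (le_trans (ler_normB _ _))//.
  have h1 := tilt_arg_le n s x y K s0 (lexx _).
  have h2 := ln_lratio_le n P Rr hP s s0 y.
  apply: le_trans (lerD h1 h2) _.
  apply: le_trans (expR_ge1Dx _); rewrite (mulrDl (K / s ^+ 2)) -/B -/c.
  rewrite [leLHS](_ : _ = K ^+ 2 / (2 * s ^+ 2) + c +
    (K / s ^+ 2 * tl1 n y + B * tl1 n y)) ?lerDr//.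
  by ring.
have mtd : measurable_fun setT (fun y => tdot n x y).
  apply: (measurableT_comp (measurable_tdot n) (g := fun y : T => (x, y))).
  exact: measurable_pair1.
have mH : measurable_fun setT H.
  apply: measurable_funB; last exact: measurable_ln_lratio.
  apply: measurable_funM => //; apply: measurable_funB => //.
  exact: measurable_funM.
have mF : measurable_fun setT (fun y => gauss_dens s (tsub y x) * H y).
  by apply: measurable_funM => //; exact: measurable_gauss_tsub1.
rewrite (leb_int_gauss_dom n s s0 _ _ _ mF (fun y =>
  gauss_dens_dom n s s0 H _ _ K x y (lexx _) (Hb y))).
have it := integrable_gauss_tdot n s x s0.
have ig := integrable_gauss_dens n s x s0.
have il := integrable_gauss_tsubM n s s0 _ _ _ measurable_ln_lratio ln_lr_dom x.
have i1 := integrableZl measurableT (s ^+ 2)^-1 it.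
have i2 := integrableZl measurableT ((2 * s ^+ 2)^-1 * tsq n x) ig.
transitivity (\int[tl]_y (((s ^+ 2)^-1 * (gauss_dens s (tsub y x) * tdot n x y) -
   (2 * s ^+ 2)^-1 * tsq n x * gauss_dens s (tsub y x)) -
   gauss_dens s (tsub y x) * ln (lr y))).
  by apply: eq_Rintegral => y _; rewrite /H; field.
have i12 := integrableB measurableT i1 i2.
rewrite RintegralB// RintegralB// !RintegralZl//.
rewrite Rintegral_gauss_tdot// Rintegral_gauss_dens//.
by congr (_ - _); field.
Qed.

Lemma gauss_MI_kl :
  gauss_MI s P = (2 * s ^+ 2)^-1 * \int[P]_x (w x * tsq n x) - kl.
Proof.
pose J x := \int[tl]_y (gauss_dens s (tsub y x) * ln (lr y)).
have mJ : measurable_fun setT J.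
  apply: (measurable_Rintegral_snd _ _ _ _ tl
    (fun p : T * T => gauss_dens s (tsub p.2 p.1) * ln (lr p.2))).
  apply: measurable_funM; first exact: measurable_gauss_tsub.
  by apply: (measurableT_comp measurable_ln_lratio).
rewrite /gauss_MI; under eq_Rintegral do rewrite inner.
rewrite (Rintegral_wball n P Rr hP); last first.
  apply: measurable_funB => //; apply: measurable_funM => //.
  exact: measurable_tsq.
transitivity (\int[P]_x ((2 * s ^+ 2)^-1 * (w x * tsq n x) - w x * J x)).
  by apply: eq_Rintegral => x _; rewrite mulrBr mulrCA.
have iq : P.-integrable setT (fun x => (w x * tsq n x)%:E).
  apply: (integrable_wball _ _ _ _ (Rr ^+ 2)); rewrite ?sqr_ge0//.
    exact: measurable_tsq.
  by move=> x xR; rewrite ger0_norm ?tsq_ge0// tsq_le.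
have iJ : P.-integrable setT (fun x => (w x * J x)%:E).
  exact: (integrable_mixture_input n P Rr s s0 _ _ _ measurable_ln_lratio ln_lr_dom).
have iq' := integrableZl measurableT (2 * s ^+ 2)^-1 iq.
rewrite RintegralB// RintegralZl//; congr (_ - _).
by rewrite klE (Rintegral_mixture n P Rr s s0 _ _ _ measurable_ln_lratio ln_lr_dom).
Qed.

End mutual_information.

(** * The divergence decreases with the noise *)

(** A comparison for [f] of any sign against a nonnegative [g] whose integral may be infinite:
    [f^+ <= g], and the negative part only lowers the left side. *)
Lemma le_integral_ge0 d (T : measurableType d) (R : realType)
    (mu : {measure set T -> \bar R}) (f g : T -> R) :
  measurable_fun setT f -> measurable_fun setT g ->
  (forall x, 0 <= g x) -> (forall x, f x <= g x) ->
  (\int[mu]_x (f x)%:E <= \int[mu]_x (g x)%:E)%E.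
Proof.
move=> mf mg g0 fg; rewrite integralE -[leRHS]sube0 leeB//; last exact: integral_ge0.
apply: ge0_le_integral => //.
- by apply: measurable_funepos; exact/measurable_EFinP.
- exact/measurable_EFinP.
- by move=> x _; rewrite funeposE ge_max !lee_fin fg g0.
Qed.

Section data_processing.
Context {R : realType} (n : nat).
Local Notation T := (n.-tuple R).
Local Notation tl := (@tlebesgue R n).
Variables (P : probability T R) (Rr : R).
Implicit Types (x y z : n.-tuple R).
Hypothesis hP : P [set x | tnorm x <= Rr] = 1%E.
Variables s1 s2 t : R.
Hypotheses (s10 : 0 < s1) (s20 : 0 < s2) (t0 : 0 < t).
Hypothesis sE : s2 ^+ 2 = s1 ^+ 2 + t ^+ 2.
Local Notation w := (wball n Rr).
Local Notation lr1 := (lratio n P Rr s1).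
Local Notation lr2 := (lratio n P Rr s2).

Let s1n : s1 != 0. Proof. by rewrite gt_eqF. Qed.
Let s2n : s2 != 0. Proof. by rewrite gt_eqF. Qed.
Let tn : t != 0. Proof. by rewrite gt_eqF. Qed.

(** The transition density from a value [z] of the first output to a value [y] of the second,
    through independent noise of deviation [t]. *)
Let G y z : R := gauss_dens t (tsub y z).

Let mG y : measurable_fun setT (G y).
Proof.
apply: (measurableT_comp (measurable_gauss_tsub n t tn) (g := fun z : T => (z, y))).
exact: measurable_pair2.
Qed.

Let G_ge0 y z : 0 <= G y z. Proof. exact/ltW/gauss_dens_gt0. Qed.

(** The kernel is bounded by its peak; the rate 0 puts this bound into the format that the mixture
    lemmas expect. *)
Let Gb y z : `|G y z| <= normal_peak t ^+ n * expR (0 * tl1 n z).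
Proof.
rewrite mul0r expR0 mulr1 ger0_norm// -[X in _ ^+ X]card_ord -prodr_const.
by apply: ler_prod => i _; rewrite normal_pdf_ge0 normal_pdf_ub.
Qed.

Let int_gauss y : \int[tl]_z (gauss_dens s1 z * G y z) = gauss_dens s2 y.
Proof.
rewrite -[RHS]gauss_dens_tsub0 -[RHS](Rintegral_gauss_conv n s1 t s2 _ _ s10 t0 s20 sE).
by apply: eq_Rintegral => z _; rewrite gauss_dens_tsub0.
Qed.

Let i_gauss y : tl.-integrable setT (fun z => (gauss_dens s1 z * G y z)%:E).
Proof.
have := integrable_gauss_conv n s1 t s2 (nseq_tuple n 0) y s10 t0 s20 sE.
by apply: eq_integrable => // z _; rewrite gauss_dens_tsub0.
Qed.

Let i_lr y : tl.-integrable setT (fun z => (gauss_dens s1 z * lr1 z * G y z)%:E).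
Proof. exact: (integrable_mixture_output n P Rr hP s1 s1n _ _ _ (mG y) (Gb y)). Qed.

Let int_lr y : \int[tl]_z (gauss_dens s1 z * lr1 z * G y z) = gauss_dens s2 y * lr2 y.
Proof.
rewrite -(Rintegral_mixture n P Rr s1 s1n _ _ _ (mG y) (Gb y)).
rewrite /lratio -RintegralZl//; last exact: integrable_tilt.
apply: eq_Rintegral => x _.
by rewrite (Rintegral_gauss_conv n s1 t s2 _ _ s10 t0 s20 sE) gauss_dens_tilt// mulrCA.
Qed.

Let m1 : measurable_fun setT (fun z => gauss_dens s1 z * psi (lr1 z)).
Proof.
apply/measurable_EFinP.
by case/integrableP : (integrable_gauss_psi n P Rr hP s1 s1n).
Qed.

(* Integrate the tangent line of [psi] at [lr2 y], composed with [lr1], against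
   the weights [G y z * gauss_dens s1 z]. *)
Let jensen y : ((gauss_dens s2 y * psi (lr2 y))%:E <=
  \int[tl]_z (G y z * (gauss_dens s1 z * psi (lr1 z)))%:E)%E.
Proof.
set b := lr2 y.
have b0 : 0 < b by exact: lratio_gt0.
have i1 := integrableZl measurableT (psi b - b * ln b) (i_gauss y).
have i2 := integrableZl measurableT (ln b) (i_lr y).
pose L z := (psi b - b * ln b) * (gauss_dens s1 z * G y z) +
             ln b * (gauss_dens s1 z * lr1 z * G y z).
have iL : tl.-integrable setT (EFin \o L) := integrableD measurableT i1 i2.
(* Under these weights [lr1] has mean exactly [b], so the slope term of the tangent averages out and
   [psi b] times the total weight remains. *)
have -> : (gauss_dens s2 y * psi b)%:E = (\int[tl]_z (L z)%:E)%E.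
  rewrite -[RHS]fineK; last exact: (integrable_fin_num measurableT iL).
  congr EFin; transitivity (\int[tl]_z L z) => //.
  rewrite RintegralD//.
  rewrite RintegralZl//; last exact: i_gauss.
  rewrite RintegralZl//; last exact: i_lr.
  by rewrite int_gauss int_lr -/b; ring.
apply: le_integral_ge0.
- by apply/measurable_EFinP; case/integrableP : iL.
- by apply: measurable_funM => //; exact: mG.
- move=> z; rewrite mulr_ge0 ?G_ge0// mulr_ge0//; first exact/ltW/gauss_dens_gt0.
  exact: psi_ge0 _ (lratio_gt0 _ _ _ hP _ _ _).
move=> z.
have -> : L z = G y z * (gauss_dens s1 z * (psi b + ln b * (lr1 z - b))).
  by rewrite /L; ring.
rewrite ler_wpM2l ?G_ge0// ler_wpM2l//; first exact/ltW/gauss_dens_gt0.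
exact: psi_tangent (lratio_gt0 n P Rr hP s1 s1n z) b0.
Qed.

(** Integrate [jensen] over [y] and swap the order by Tonelli: the kernel has mass 1 as a function
    of [y], so the right side collapses to the divergence at [s1]. *)
Lemma kl_le : kl n P Rr s2 <= kl n P Rr s1.
Proof.
have i1 := integrable_gauss_psi n P Rr hP s1 s1n.
have i2 := integrable_gauss_psi n P Rr hP s2 s2n.
rewrite -lee_fin /kl /Rintegral.
rewrite [leLHS](fineK (integrable_fin_num measurableT i2)).
rewrite [leRHS](fineK (integrable_fin_num measurableT i1)).
pose F (p : T * T) : \bar R :=
  (G p.2 p.1 * (gauss_dens s1 p.1 * psi (lr1 p.1)))%:E.
have mF : measurable_fun setT F.
  apply/measurable_EFinP; apply: measurable_funM; first exact: measurable_gauss_tsub.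
  by apply: (measurableT_comp m1).
have q0 z : 0 <= gauss_dens s1 z * psi (lr1 z).
  rewrite mulr_ge0//; first exact/ltW/gauss_dens_gt0.
  exact: psi_ge0 _ (lratio_gt0 _ _ _ hP _ _ _).
have F0 p : (0 <= F p)%E by rewrite lee_fin mulr_ge0 ?G_ge0.
apply: (@le_trans _ _ (\int[tl]_y \int[tl]_z F (z, y))%E).
  apply: ge0_le_integral => //.
  - move=> y _; rewrite lee_fin mulr_ge0//; first exact/ltW/gauss_dens_gt0.
    exact: psi_ge0 _ (lratio_gt0 _ _ _ hP _ _ _).
  - by case/integrableP : i2.
  - exact: measurable_fun_fubini_tonelli_G.
rewrite -(fubini_tonelli F mF F0).
rewrite le_eqVlt; apply/orP; left; apply/eqP; apply: eq_integral => z _.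
rewrite (eq_integral (fun y => (gauss_dens s1 z * psi (lr1 z))%:E *
  (gauss_dens t (tsub y z))%:E)%E); last by move=> y _; rewrite -EFinM mulrC.
rewrite integralZl//; last exact: integrable_gauss_dens.
have := Rintegral_gauss_dens n t z tn; rewrite /Rintegral => h.
rewrite -[X in (_ * X)%E]fineK ?h ?mule1//.
exact: (integrable_fin_num measurableT (integrable_gauss_dens n t z tn)).
Qed.

End data_processing.

(** * Uniform inputs on the coordinate axes *)

Section unif_points.
Context d (T : measurableType d) (R : realType) (m : nat) (v : nat -> T).

Let p_ge0 : 0 <= m.+1%:R^-1 :> R. Proof. by rewrite invr_ge0. Qed.

(** Taking [m.+1] points keeps the normalisation meaningful. Repetitions are allowed, and do occur
    for the spikes when the radius is 0. *)
Definition unif_points : set T -> \bar R :=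
  mscale (NngNum p_ge0) (msum (fun k => \d_(v k)) m.+1).

HB.instance Definition _ := Measure.on unif_points.

Let unif_pointsT : unif_points setT = 1%E.
Proof.
rewrite /unif_points /mscale/= /msum/=.
under eq_bigr do rewrite diracT.
by rewrite sumEFin -EFinM sumr_const card_ord mulVf.
Qed.

HB.instance Definition _ :=
  @Measure_isProbability.Build _ _ _ unif_points unif_pointsT.

Lemma ge0_integral_unif_points (f : T -> R) : measurable_fun setT f ->
  (forall x, 0 <= f x) ->
  (\int[unif_points]_x (f x)%:E)%E = (m.+1%:R^-1 * \sum_(k < m.+1) f (v k))%:E.
Proof.
move=> mf f0; have mf' : measurable_fun setT (EFin \o f) by exact/measurable_EFinP.
have f0' x : [set: T] x -> (0 <= (EFin \o f) x)%E by rewrite lee_fin f0.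
rewrite [LHS](ge0_integral_mscale _ _ _ mf' f0')//=.
rewrite [X in (_ * X)%E](ge0_integral_measure_sum _ _ f0' mf')//.
rewrite EFinM -sumEFin; congr (_ * _)%E; apply: eq_bigr => k _.
by rewrite integral_dirac// diracT mul1e.
Qed.

End unif_points.

Section Rintegral_sum.
Context d (T : measurableType d) (R : realType) (mu : {measure set T -> \bar R}).

Lemma integrable_EFin_sum (I : finType) (f : I -> T -> R) :
  (forall i, mu.-integrable setT (fun x => (f i x)%:E)) ->
  mu.-integrable setT (fun x => (\sum_i f i x)%:E).
Proof.
move=> fi; under eq_fun do rewrite -sumEFin.
by apply: integrable_sum => // i _; exact: fi.
Qed.

Lemma Rintegral_sum (I : finType) (f : I -> T -> R) :
  (forall i, mu.-integrable setT (fun x => (f i x)%:E)) ->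
  \int[mu]_x (\sum_i f i x) = \sum_i \int[mu]_x f i x.
Proof.
move=> fi; rewrite /Rintegral.
under eq_integral do rewrite -sumEFin.
rewrite integral_sum// (eq_bigr (fun i => (\int[mu]_x f i x)%:E)) ?sumEFin// => i _.
by rewrite /Rintegral fineK//; exact: (integrable_fin_num measurableT (fi i)).
Qed.

End Rintegral_sum.

Section spikes.
Context {R : realType} (m : nat) (Rr : R).
Local Notation n := m.+1.
Local Notation T := (n.-tuple R).
Local Notation tl := (@tlebesgue R n).
Hypothesis Rr0 : 0 <= Rr.

(** The index is a natural number to fit [unif_points]; an index beyond the dimension would give the
    zero vector, but the average stops before it. *)
Definition spike (k : nat) : T := [tuple if (j : nat) == k then Rr else 0 | j < n].

Lemma tdot_spike (k l : 'I_n) :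
  tdot n (spike k) (spike l) = if k == l then Rr ^+ 2 else 0.
Proof.
rewrite /tdot (bigD1 k)//= !tnth_mktuple eqxx big1 ?addr0; last first.
  by move=> j jk; rewrite !tnth_mktuple (negbTE (_ : (j : nat) != k))// mul0r.
by rewrite -[(_ : nat) == _]/(k == l); case: ifP => _; rewrite ?mulr0.
Qed.

Lemma tsq_spike (k : 'I_n) : tsq n (spike k) = Rr ^+ 2.
Proof.
by have := tdot_spike k k; rewrite eqxx => <-; apply: eq_bigr => j _; rewrite expr2.
Qed.

Lemma tnorm_spike (k : 'I_n) : tnorm (spike k) = Rr.
Proof. by rewrite /tnorm -/(tsq n (spike k)) tsq_spike sqrtr_sqr ger0_norm. Qed.

Definition spikes : probability T R := unif_points _ T R m spike.

Lemma wball_spike (k : 'I_n) : wball n Rr (spike k) = 1.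
Proof. by rewrite /wball indicE mem_set//= tnorm_spike. Qed.

Lemma spikes_ball : spikes [set x | tnorm x <= Rr] = 1%E.
Proof.
have mb := measurable_tnorm_le m.+1 Rr (R := R).
transitivity (\int[spikes]_x (wball n Rr x)%:E)%E.
  by rewrite integral_indic// setIT.
rewrite ge0_integral_unif_points; [|exact: measurable_wball|exact: wball_ge0].
under eq_bigr do rewrite wball_spike.
by rewrite sumr_const card_ord mulVf.
Qed.

Lemma spikes_tsq : \int[spikes]_x (wball n Rr x * tsq n x) = Rr ^+ 2.
Proof.
rewrite /Rintegral ge0_integral_unif_points.
- under eq_bigr do rewrite wball_spike tsq_spike mul1r.
  by rewrite sumr_const card_ord /= -[X in _ * X]mulr_natl mulKf.
- by apply: measurable_funM; [exact: measurable_wball|exact: measurable_tsq].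
- by move=> x; rewrite mulr_ge0 ?wball_ge0 ?tsq_ge0.
Qed.

Lemma spikes_lratio s y :
  lratio n spikes Rr s y = n%:R^-1 * \sum_(k < n) tilt n s (spike k) y.
Proof.
rewrite /lratio /Rintegral ge0_integral_unif_points.
- by under eq_bigr do rewrite wball_spike mul1r.
- apply: measurable_funM; first exact: measurable_wball.
  apply: (measurableT_comp (measurable_tilt n s) (g := fun x : T => (x, y))).
  exact: measurable_pair2.
- by move=> x; rewrite mulr_ge0 ?wball_ge0// ltW// tilt_gt0.
Qed.

End spikes.

(** * The chi-square divergence and its value for the spike input *)

Section chi2.
Context {R : realType} (n : nat).
Local Notation T := (n.-tuple R).
Local Notation tl := (@tlebesgue R n).
Variables (P : probability T R) (Rr : R).
Implicit Types (x y : n.-tuple R).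
Hypothesis hP : P [set x | tnorm x <= Rr] = 1%E.
Variable s : R.
Hypothesis s0 : s != 0.
Local Notation lr := (lratio n P Rr s).

Lemma integrable_gauss_lr2 :
  tl.-integrable setT (fun y => (gauss_dens s y * lr y * lr y)%:E).
Proof.
apply: (integrable_mixture_output n P Rr hP s s0 lr
  (expR (Rr ^+ 2 / (2 * s ^+ 2))) (Rr / s ^+ 2)).
  exact: measurable_lratio.
move=> y; rewrite -expRD addrC ger0_norm; first exact: lratio_le.
exact/ltW/lratio_gt0.
Qed.

Lemma kl_le_chi2 : kl n P Rr s <= \int[tl]_y (gauss_dens s y * lr y * lr y) - 1.
Proof.
have i1 := integrable_gauss_lr n P Rr hP s s0.
have i0 := integrable_gauss0 n s s0.
have i2 := integrable_gauss_lr2.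
have i21 := integrableB measurableT i2 i1.
have i10 := integrableB measurableT i1 i0.
(* Regrouped, the integrand is the noise density times [(lr y - 1) ^+ 2]. The first bracket
   integrates to the left side and the second to 0. *)
have -> : \int[tl]_y (gauss_dens s y * lr y * lr y) - 1 =
    \int[tl]_y ((gauss_dens s y * lr y * lr y - gauss_dens s y * lr y * 1) -
                (gauss_dens s y * lr y * 1 - gauss_dens s y)).
  rewrite RintegralB// RintegralB// RintegralB//.
  rewrite (Rintegral_gauss_lr n P Rr hP s s0) (Rintegral_gauss0 n s s0).
  by rewrite subrr subr0.
apply: le_Rintegral => //.
- exact: (integrable_gauss_psi n P Rr hP s s0).
- exact: (integrableB measurableT i21 i10).
move=> y _; have g0 := ltW (gauss_dens_gt0 n s y s0).
apply: le_trans (ler_wpM2l g0 (psi_le_sqr _ (lratio_gt0 n P Rr hP s s0 y))) _.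
by rewrite le_eqVlt; apply/orP; left; apply/eqP; ring.
Qed.

Definition tadd x y : T := [tuple tnth x i + tnth y i | i < n].

(** Two tilts combine into a single shift by the sum, at the price of the cross term of the square.
    Integrating over [y] leaves only [exp (<x, x'> / s^2)], which is how inner products enter the
    chi-square divergence. *)
Lemma gauss_dens_tilt2 x x' y :
  gauss_dens s y * (tilt n s x y * tilt n s x' y) =
  expR (tdot n x x' / s ^+ 2) * gauss_dens s (tsub y (tadd x x')).
Proof.
rewrite gauss_dens_tilt// [RHS]mulrCA; congr *%R.
rewrite /tilt -!expRD; congr expR.
have -> : tdot n (tadd x x') y = tdot n x y + tdot n x' y.
  by rewrite -big_split/=; apply: eq_bigr => i _; rewrite tnth_mktuple mulrDl.
have -> : tsq n (tadd x x') = tsq n x + tsq n x' + 2 * tdot n x x'.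
  rewrite mulr_sumr -!big_split/=; apply: eq_bigr => i _.
  by rewrite tnth_mktuple; ring.
by field.
Qed.

End chi2.

Section spikes_kl.
Context {R : realType} (m : nat) (Rr s : R).
Local Notation n := m.+1.
Local Notation T := (n.-tuple R).
Local Notation tl := (@tlebesgue R n).
Hypothesis Rr0 : 0 <= Rr.
Hypothesis s0 : s != 0.
Local Notation P := (spikes m Rr).
Local Notation lr := (lratio n P Rr s).

Let i_term (p : 'I_n * 'I_n) : tl.-integrable setT (fun y =>
  (expR (tdot n (spike m Rr p.1) (spike m Rr p.2) / s ^+ 2) *
   gauss_dens s (tsub y (tadd n (spike m Rr p.1) (spike m Rr p.2))))%:E).
Proof. exact: (integrableZl measurableT _ (integrable_gauss_dens n s _ s0)). Qed.

(** Expanding the square gives [n ^+ 2] ordered pairs: the [n] diagonal ones contribute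
    [expR (Rr ^+ 2 / s ^+ 2)] each, and the [n * m] orthogonal ones contribute 1 each. *)
Lemma spikes_lr2 : \int[tl]_y (gauss_dens s y * lr y * lr y) =
  1 + (expR (Rr ^+ 2 / s ^+ 2) - 1) / n%:R.
Proof.
transitivity (\int[tl]_y (n%:R^-1 ^+ 2 * \sum_(p : 'I_n * 'I_n)
  expR (tdot n (spike m Rr p.1) (spike m Rr p.2) / s ^+ 2) *
  gauss_dens s (tsub y (tadd n (spike m Rr p.1) (spike m Rr p.2))))).
  apply: eq_Rintegral => y _; rewrite spikes_lratio//.
  under [in RHS]eq_bigr do rewrite -gauss_dens_tilt2//.
  rewrite -mulr_sumr -(pair_big predT predT (fun i j : 'I_n =>
    tilt n s (spike m Rr i) y * tilt n s (spike m Rr j) y))/=.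
  by rewrite -big_distrlr/=; ring.
rewrite RintegralZl//; last first.
  exact: (integrable_EFin_sum _ _ _ _ _ _ i_term).
rewrite Rintegral_sum; last exact: i_term.
under eq_bigr => p _.
  rewrite RintegralZl//; last exact: integrable_gauss_dens.
  rewrite Rintegral_gauss_dens// mulr1 tdot_spike//.
  over.
rewrite -(pair_big predT predT (fun i j : 'I_n =>
  expR ((if i == j then Rr ^+ 2 else 0) / s ^+ 2)))/=.
under eq_bigr => i _.
  rewrite (bigD1 i)//= eqxx (eq_bigr (fun=> 1)); last first.
    by move=> j; rewrite eq_sym => /negbTE ->; rewrite mul0r expR0.
  rewrite sumr_const cardC1 card_ord/=.
  over.
rewrite sumr_const card_ord -[X in _ * X]mulr_natl.
have -> : n%:R = m%:R + 1 :> R by rewrite -natr1.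
field.
by rewrite natr1 pnatr_eq0.
Qed.

Lemma kl_spikes : kl n P Rr s <= (expR (Rr ^+ 2 / s ^+ 2) - 1) / n%:R.
Proof.
have hP : P [set x | tnorm x <= Rr] = 1%E by exact: spikes_ball.
apply: le_trans (kl_le_chi2 n P Rr hP s s0) _.
by rewrite spikes_lr2 addrC addKr.
Qed.

End spikes_kl.

(** * Two-sided bounds on the capacity and the limit *)

Section capacity.
Context {R : realType} (Rr s1 s2 : R).
Hypotheses (Rr0 : 0 <= Rr) (s10 : 0 < s1) (s12 : s1 < s2).
Let L := Rr ^+ 2 * ((2 * s1 ^+ 2)^-1 - (2 * s2 ^+ 2)^-1).

Let s20 : 0 < s2. Proof. exact: lt_trans s12. Qed.
Let s1n : s1 != 0. Proof. by rewrite gt_eqF. Qed.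
Let s2n : s2 != 0. Proof. by rewrite gt_eqF. Qed.

Lemma gauss_MI_sub_le n (P : probability (n.-tuple R) R) :
  P [set x | tnorm x <= Rr] = 1%E -> gauss_MI s1 P - gauss_MI s2 P <= L.
Proof.
move=> hP; rewrite (gauss_MI_kl n P Rr hP s1 s1n) (gauss_MI_kl n P Rr hP s2 s2n).
have sq : s1 ^+ 2 < s2 ^+ 2 by rewrite ltr_pXn2r// nnegrE ltW.
have d0 : 0 < s2 ^+ 2 - s1 ^+ 2 by rewrite subr_gt0.
(* The noise added to pass from the first output to the second has variance [s2 ^+ 2 - s1 ^+ 2]. *)
have := kl_le n P Rr hP s1 s2 (Num.sqrt (s2 ^+ 2 - s1 ^+ 2)) s10 s20.
rewrite sqrtr_gt0 (sqr_sqrtr (ltW d0)) => /(_ d0); rewrite subrKC => /(_ erefl).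
set k1 := kl _ _ _ s1; set k2 := kl _ _ _ s2 => k21.
set E := \int[P]_x _.
have E_le : E <= Rr ^+ 2.
  rewrite -[leRHS]mulr1 -(integral_wball1 n P Rr hP) -RintegralZl//; last first.
    exact: integrable_wball1.
  have msq := measurable_tsq n (R := R).
  apply: le_Rintegral => //.
  - apply: (integrable_wball _ _ _ _ (Rr ^+ 2)); rewrite ?sqr_ge0//.
    by move=> x xR; rewrite ger0_norm ?tsq_ge0// tsq_le.
  - exact: (integrableZl measurableT (Rr ^+ 2) (integrable_wball1 n P Rr)).
  move=> x _; case: (wball_cases n Rr x) => [[-> xR]|->].
    by rewrite mul1r !mulr1 tsq_le.
  by rewrite !mul0r mulr0.
have v : 0 <= (2 * s1 ^+ 2)^-1 - (2 * s2 ^+ 2)^-1.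
  by rewrite subr_ge0 lef_pV2 ?posrE ?mulr_gt0 ?exprn_gt0// ler_pM2l// ltW.
have : E * ((2 * s1 ^+ 2)^-1 - (2 * s2 ^+ 2)^-1) <= L by rewrite ler_wpM2r.
lra.
Qed.

(** A real [sup] is informative only for a nonempty set bounded above: the spike input provides an
    element, [gauss_MI_sub_le] the bound. On the lower side the divergence at [s2] enters with a
    plus sign and is dropped by [kl_ge0], so the only loss is [kl_spikes] at [s1]. *)
Lemma Cs_bounds m :
  L - (expR (Rr ^+ 2 / s1 ^+ 2) - 1) / m.+1%:R <= Cs s1 s2 Rr m.+1 <= L.
Proof.
have hP : spikes m Rr [set x | tnorm x <= Rr] = 1%E by exact: spikes_ball.
set A := [set r : R | exists P : probability (m.+1.-tuple R) R,
  P [set x | tnorm x <= Rr] = 1%E /\ r = gauss_MI s1 P - gauss_MI s2 P].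
have Aub : ubound A L by move=> _ [P [h ->]]; exact: gauss_MI_sub_le.
have As : A (gauss_MI s1 (spikes m Rr) - gauss_MI s2 (spikes m Rr)).
  by exists (spikes m Rr).
apply/andP; split; last by apply: ge_sup => //; eexists; exact: As.
apply: (@le_trans _ _ (gauss_MI s1 (spikes m Rr) - gauss_MI s2 (spikes m Rr))).
  rewrite (gauss_MI_kl _ _ Rr hP s1 s1n) (gauss_MI_kl _ _ Rr hP s2 s2n).
  rewrite spikes_tsq//.
  have := kl_ge0 m.+1 (spikes m Rr) Rr hP s2 s2n.
  have := kl_spikes m Rr s1 Rr0 s1n.
  set q := _ / m.+1%:R; set a := (2 * s1 ^+ 2)^-1; set b := (2 * s2 ^+ 2)^-1.
  rewrite (_ : L = a * Rr ^+ 2 - b * Rr ^+ 2); last by rewrite /L mulrBr !(mulrC (Rr ^+ 2)).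
  move: (kl m.+1 (spikes m Rr) Rr s1) (kl m.+1 (spikes m Rr) Rr s2) => k1 k2.
  move: (a * Rr ^+ 2) (b * Rr ^+ 2) q => u v q; lra.
by apply: ub_le_sup => //; exists L.
Qed.

End capacity.

Theorem theorem6 (R : realType) (Rr s1 s2 : R) :
  AssumptionA R -> 0 <= Rr -> 0 < s1 -> s1 < s2 ->
  Cs s1 s2 Rr n @[n --> \oo] -->
    Rr ^+ 2 * ((2 * s1 ^+ 2)^-1 - (2 * s2 ^+ 2)^-1).
Proof.
move=> _ Rr0 s10 s12; set L := (X in _ --> X).
(* Dimension 0 carries no spike; after the shift the error term is [harmonic m], that is
   [1 / (m + 1)]. *)
rewrite -cvg_shiftS /=.
apply: (@squeeze_cvgr _ _ _ _ (fun m =>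
  L - (expR (Rr ^+ 2 / s1 ^+ 2) - 1) * harmonic m) (cst L)).
- by apply: nearW => m; exact: Cs_bounds.
- rewrite -[X in _ --> X]subr0 -(mulr0 (expR (Rr ^+ 2 / s1 ^+ 2) - 1)).
  apply: cvgB; first exact: cvg_cst.
  by apply: cvgM; [exact: cvg_cst|exact: cvg_harmonic].
- exact: cvg_cst.
Qed.
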